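(* Let $c \in [1,4/3)$. Then $c$ is the threshold for diameter 2 for the family of groups $((C_2)^n \times D_{2m_n})_n$, where $m_n = \lfloor 2^{\frac{(4-3c)n}{3c}} \rfloor$ and $D_{2m}$ is the dihedral group of order $2m$.
   Context: For a finite group $G$ and a subset $S \subseteq G$, the Cayley graph $\Gamma(G;S)$ has vertex set $G$ and an edge between distinct $g,h$ if and only if $hg^{-1} \in S$ or $gh^{-1} \in S$ (loops and multiple edges are ignored). The random model $\mathcal{G}(G,p)$ is the probability space of graphs $\Gamma(G;S)$ where each element of $G$ is put in $S$ independently with probability $p$. The diameter of a disconnected graph is taken to be infinite. Let $(G_k)$ be a family of finite groups of orders $n_k$ with $n_k \to \infty$. A real $c>0$ is the threshold for diameter 2 for $(G_k)$ if for every $\varepsilon>0$, with probability tending to $1$ as $k\to\infty$, $\Gamma \in \mathcal{G}(G_k,p)$ has diameter greater than 2 if $p \leqslant \sqrt{(c-\varepsilon)\frac{\log n_k}{n_k}}$ and has diameter at most 2 if $p \geqslant \sqrt{(c+\varepsilon)\frac{\log n_k}{n_k}}$. *)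

(* Defs.v *)
From HB Require Import structures.
From mathcomp Require Import all_boot all_order all_algebra.
From mathcomp Require Import all_fingroup all_solvable.
From mathcomp Require Import all_classical all_reals all_analysis.

Set Implicit Arguments.
Unset Strict Implicit.
Unset Printing Implicit Defensive.

Import Order.TTheory GRing.Theory Num.Theory.
Import numFieldNormedType.Exports.

Local Open Scope classical_set_scope.
Local Open Scope ring_scope.

Section Diameter.
Variables (R : realType) (T : finType).

(* Lengths of the walks from x to y; [ereal_inf set0 = +oo], so vertices in
   different components are at distance +oo. *)
Definition graph_dist (e : rel T) (x y : T) : \bar R :=
  ereal_inf [set ((size s)%:R%:E : \bar R) |
              s in [set s : seq T | path e x s /\ last x s = y]].

Definition diameter (e : rel T) : \bar R :=
  ereal_sup [set graph_dist e xy.1 xy.2 | xy in [set: T * T]].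

End Diameter.

Definition cayley (gT : finGroupType) (S : {set gT}) : rel gT :=
  fun g h => (g != h) && ((h * g^-1 \in S)%g || (g * h^-1 \in S)%g).

(* Probability that the Cayley graph of S satisfies E, when each element of gT
   is put in S independently with probability p. *)
Definition Pr_cayley (R : realType) (gT : finGroupType) (p : R)
    (E : pred (rel gT)) : R :=
  \sum_(S : {set gT} | E (cayley S))
    \prod_(g : gT) (if g \in S then p else 1 - p).

(* The edge probability p may depend on k. The bounds on p are only required
   for large k: the second one may exceed 1 for small k. *)
Definition threshold_diam2 (R : realType) (G : nat -> finGroupType) (c : R) :=
  let n k := #|{: G k}| in
  let bound (a : R) k := Num.sqrt (a * (ln (n k)%:R / (n k)%:R)) in
  [/\ 0 < c,
      n k @[k --> \oo] --> \oo &
      forall eps : R, 0 < eps ->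
      forall p : nat -> R, (forall k, 0 <= p k <= 1) ->
        ((\forall k \near \oo, p k <= bound (c - eps) k) ->
           Pr_cayley (p k) (fun e : rel (G k) => (2%:E < diameter R e)%E)
             @[k --> \oo] --> (1 : R))
        /\
        ((\forall k \near \oo, bound (c + eps) k <= p k) ->
           Pr_cayley (p k) (fun e : rel (G k) => (diameter R e <= 2%:E)%E)
             @[k --> \oo] --> (1 : R))].

(* Dihedral group of order 2m, for m > 0; [dihedral_gtype (2 * m)] has order
   2m only for m > 1. *)
Definition dihedral (m : nat) : finGroupType :=
  if m == 1%N then ('Z_2 : finGroupType) else dihedral_gtype (2 * m)%N.

Definition C2_pow (n : nat) : finGroupType := {dffun forall _ : 'I_n, 'Z_2}.

Definition dihedral_param (R : realType) (c : R) (n : nat) : nat :=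
  Num.truncn (2 `^ ((4 - 3 * c) * n%:R / (3 * c))).

(* Main.v *)
Require Import Defs.
From HB Require Import structures.
From mathcomp Require Import all_boot all_order all_algebra.
From mathcomp Require Import all_fingroup all_solvable.
From mathcomp Require Import all_classical all_reals all_analysis.
From mathcomp Require Import ring lra zify.

Set Implicit Arguments.
Unset Strict Implicit.
Unset Printing Implicit Defensive.

Import Order.TTheory GRing.Theory Num.Theory.
Import numFieldNormedType.Exports.

Local Open Scope ring_scope.

(** Write T for the union of S and S^-1: the Cayley graph has diameter at most 2
    iff every x <> 1 lies in T or in T T. When x does not, S is an independent
    set of the graph H_x of bounded degree joining s and t whenever x is a product
    of s^{+-1} and t^{+-1}. For a graph with e edges and degrees at most d, exposing
    one vertex at a time shows that a p-random set is independent with probability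
    at least (1 - p^2)^e and at most exp(- e p^2 (1 - 4 d p)).

    In a group of order N = 2^n 2m, with rotations K of index 2, H_x has about
    3N/4 edges if x is one of the at most 2^(n+1) rotations with x^2 = 1, and at
    least about N edges otherwise. With p^2 = C ln N / N the union bound is
    N^(1 - C) + 2^(n+1) N^(- 3C/4), and 2^n is about N^(3c/4); hence the diameter is
    at most 2 if C > c. If C < c, the second moment method applied to the central
    involutions (v, 1) yields an unreachable one, as the graphs H_x of two of them
    share no edge. *)

(** * Random subsets of a finite set and independent sets of a graph *)

Section RandomSubset.
Import mathcomp.boot.fintype mathcomp.boot.finset.
Variables (R : realType) (T : finType) (p : R).
Hypothesis p01 : 0 <= p <= 1.
Implicit Types (A B S : {set T}) (E F : pred {set T}) (v : T).

Let p0 : 0 <= p. Proof. by case/andP: p01. Qed.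
Let q0 : 0 <= 1 - p. Proof. by rewrite subr_ge0; case/andP: p01. Qed.

Definition weight S : R := \prod_g (if g \in S then p else 1 - p).

Definition Pr E : R := \sum_(S | E S) weight S.

Lemma weight_ge0 S : 0 <= weight S.
Proof. by apply: prodr_ge0 => g _; case: ifP. Qed.

Lemma PrE E : Pr E = \sum_S (E S)%:R * weight S.
Proof.
rewrite /Pr big_mkcond; apply: eq_bigr => S _.
by case: (E S); rewrite ?mul1r ?mul0r.
Qed.

Lemma Pr_ge0 E : 0 <= Pr E.
Proof. by apply: sumr_ge0 => S _; apply: weight_ge0. Qed.

Lemma eq_Pr E F : (forall S, E S = F S) -> Pr E = Pr F.
Proof. by move=> eqEF; apply: eq_bigl. Qed.

Lemma Pr_mono E F : (forall S, E S -> F S) -> Pr E <= Pr F.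
Proof.
move=> sEF; rewrite !PrE; apply: ler_sum => S _.
apply: ler_wpM2r; first exact: weight_ge0.
by rewrite ler_nat; case: (E S) (sEF S) => // ->.
Qed.

Lemma Pr_pred0 : Pr (fun=> false) = 0.
Proof. exact: big_pred0_eq. Qed.

Lemma Pr_predT : Pr (fun=> true) = 1.
Proof.
have := @bigA_distr R 0 1 *%R +%R T (fun=> p) (fun=> 1 - p).
rewrite big1 => [|g _]; last by rewrite /=; ring.
by move=> ->; apply: eq_bigl.
Qed.

Lemma Pr_le1 E : Pr E <= 1.
Proof. by rewrite -Pr_predT; apply: Pr_mono. Qed.

Lemma Pr_negb E : Pr (fun S => ~~ E S) = 1 - Pr E.
Proof.
rewrite -Pr_predT !PrE -sumrB; apply: eq_bigr => S _.
by case: (E S); rewrite ?mul1r ?mul0r ?subrr ?subr0.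
Qed.

Lemma Pr_exists_le (I : finType) (P : pred I) (E : I -> pred {set T}) :
  Pr (fun S => [exists i, P i && E i S]) <= \sum_(i | P i) Pr (E i).
Proof.
under eq_bigr do rewrite PrE.
rewrite PrE exchange_big; apply: ler_sum => S _ /=.
rewrite -mulr_suml; apply: ler_wpM2r; first exact: weight_ge0.
case: existsP => [[i /andP[Pi Ei]]|_]; last exact: sumr_ge0.
by rewrite (bigD1 i) //= Ei lerDl; apply: sumr_ge0.
Qed.

(** Exposing the single element [v]. Both conditional events are written with [S :\ v] and [v |: S],
    so that every probability stays on the subsets of the same [T]. *)
Lemma Pr_cond v E :
  Pr E = (1 - p) * Pr (fun S => E (S :\ v)) + p * Pr (fun S => E (v |: S)).
Proof.
have split_v (g : {set T} -> R) :
    \sum_S g S = \sum_(S : {set T} | v \notin S) (g S + g (v |: S)).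
  rewrite (bigID (fun S : {set T} => v \in S)) /= addrC big_split /=.
  congr (_ + _).
  rewrite (reindex_onto (fun S => v |: S) (fun S => S :\ v)) /=; last first.
    by move=> S vS; rewrite setD1K.
  apply: eq_bigl => S; rewrite setU11 /=; apply/eqP/idP => [<-|vS].
    by rewrite setD11.
  by rewrite setU1K.
pose w S : R := \prod_(g | g != v) (if g \in S then p else 1 - p).
have wN S : v \notin S -> weight S = (1 - p) * w S.
  by move=> vS; rewrite /weight (bigD1 v) //= (negbTE vS).
have wU S : v \notin S -> weight (v |: S) = p * w S.
  move=> vS; rewrite /weight (bigD1 v) //= setU11; congr (_ * _).
  by apply: eq_bigr => g gv; rewrite in_setU1 (negbTE gv).
rewrite !PrE !split_v !mulr_sumr -big_split /=; apply: eq_bigr => S vS.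
rewrite setUA setUid setU1K // wN // wU //.
have -> : S :\ v = S by apply/setDidPl; rewrite disjoint_sym disjoints1.
by ring.
Qed.

Lemma setU1_ind (P : {set T} -> Prop) :
  P set0 -> (forall v B, v \notin B -> P B -> P (v |: B)) -> forall B, P B.
Proof.
move=> P0 PU B; have [n] := ubnP #|B|; elim: n B => // n IH B ltB.
have [->//|[v vB]] := set_0Vmem B; rewrite -(setD1K vB); apply: PU.
  by rewrite setD11.
by apply: IH; move: ltB; rewrite (cardsD1 v) vB.
Qed.

(** An event that ignores the elements of [B] is independent of what [S] does on [B]; the elements
    of [B] are exposed one at a time. *)
Lemma Pr_avoid B E : (forall v S, v \in B -> E (S :\ v) = E S) ->
  Pr (fun S => [disjoint B & S] && E S) = (1 - p) ^+ #|B| * Pr E.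
Proof.
elim/setU1_ind: B => [|v B vB IH] inv.
  rewrite cards0 expr0 mul1r; apply: eq_Pr => S.
  by rewrite -setI_eq0 set0I eqxx.
rewrite (Pr_cond v) cardsU1 vB add1n exprS -mulrA -IH; last first.
  by move=> u S uB; apply: inv; rewrite setU1r.
rewrite [X in _ + p * X](_ : _ = 0) ?mulr0 ?addr0; last first.
  rewrite -Pr_pred0; apply: eq_Pr => S; apply/negbTE.
  rewrite negb_and -setI_eq0; apply/orP; left; apply/set0Pn; exists v.
  by rewrite !inE eqxx.
congr (_ * _); apply: eq_Pr => S; rewrite inv ?setU11 //; congr (_ && _).
rewrite -!setI_eq0; congr (_ == _); apply/setP => u; rewrite !inE.
by case: eqP => [->|] //=; rewrite (negbTE vB).
Qed.

Section IndependentSets.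
Variable e : rel T.
Hypotheses (e_sym : symmetric e) (e_irr : irreflexive e).

Definition nbr A v : {set T} := [set u in A | e v u].
(** Counts ordered pairs, hence twice the edges inside [A]; this is the source of the doublings and
    halvings below. *)
Definition arcs A : nat := \sum_(v in A) #|nbr A v|.
Definition indep A S : bool := [forall s in A :&: S, nbr (A :&: S) s == set0].

Lemma indepP A S : reflect
  (forall s t, s \in A -> s \in S -> t \in A -> t \in S -> ~~ e s t)
  (indep A S).
Proof.
apply: (iffP forall_inP) => [ind s t sA sS tA tS|ind s].
  have /ind/eqP : s \in A :&: S by rewrite inE sA.
  by move/setP/(_ t); rewrite !inE tA tS /= => ->.
rewrite inE => /andP[sA sS]; apply/eqP/setP => t; rewrite !inE.
by apply/negbTE/negP => /andP[/andP[tA tS]]; apply/negP/ind.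
Qed.

Lemma indep0 S : indep set0 S.
Proof. by apply/indepP => s t; rewrite inE. Qed.

Lemma indepD1 A S v : indep A (S :\ v) = indep (A :\ v) S.
Proof.
apply/indepP/indepP => ind s t.
  by rewrite !inE => /andP[sv sA] sS /andP[tv tA] tS; apply: ind; rewrite ?inE ?sv ?tv.
by rewrite !inE => sA /andP[sv sS] tA /andP[tv tS]; apply: ind; rewrite ?inE ?sv ?tv.
Qed.

Lemma indep_subset A B S : A \subset B -> indep B S -> indep A S.
Proof.
by move=> /subsetP AB /indepP ind; apply/indepP => s t /AB sB sS /AB tB tS; apply: ind.
Qed.

Lemma indepU1 A S v : v \in A ->
  indep A (v |: S) =
  [disjoint nbr A v & S] && indep (A :\ v :\: nbr A v) S.
Proof.
move=> vA; apply/indepP/andP => [ind|[]].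
  split.
    rewrite -setI_eq0; apply/eqP/setP => u; rewrite !inE; apply/negbTE.
    apply/negP => /andP[/andP[uA vu] uS].
    by have := ind v u vA (setU11 _ _) uA; rewrite inE uS orbT vu => /(_ isT).
  apply/indepP => s t; rewrite !inE => /andP[_ /andP[_ sA]] sS.
  by move=> /andP[_ /andP[_ tA]] tS; apply: ind; rewrite // !inE ?sS ?tS orbT.
rewrite -setI_eq0 => /eqP/setP dis /indepP ind.
have vN u : u \in A -> u \in S -> e v u = false.
  by move=> uA uS; have := dis u; rewrite !inE uA uS andbT.
move=> s t sA + tA; rewrite !inE.
have [->|sv] := eqVneq s v; have [->|tv] := eqVneq t v => /=.
- by rewrite e_irr.
- by move=> _ tS; rewrite vN.
- by move=> sS _; rewrite e_sym vN.
by move=> sS tS; apply: ind; rewrite // !inE ?sv ?tv ?sA ?tA ?vN.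
Qed.

(** Expose [v]. If it is not in [S], it can be deleted from the graph; if it is, all its neighbours
    must be outside [S], and only the rest of the graph still matters. *)
Lemma Pr_indep_rec A v : v \in A ->
  Pr (indep A) = (1 - p) * Pr (indep (A :\ v)) +
    p * ((1 - p) ^+ #|nbr A v| * Pr (indep (A :\ v :\: nbr A v))).
Proof.
move=> vA; rewrite (Pr_cond v); congr (_ * _ + _ * _).
  by apply: eq_Pr => S; rewrite indepD1.
rewrite -Pr_avoid; first by apply: eq_Pr => S; rewrite indepU1.
move=> u S uN; rewrite indepD1; congr (indep _ _); apply/setP => w.
by rewrite !inE; case: eqP => // ->; move: uN; rewrite !inE => ->.
Qed.

Lemma arcsD1 A v : v \in A -> arcs A = (arcs (A :\ v) + #|nbr A v|.*2)%N.
Proof.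
move=> vA; have nbrE u : u \in A :\ v -> #|nbr A u| = (e v u + #|nbr (A :\ v) u|)%N.
  rewrite !inE => /andP[uv uA]; rewrite (cardsD1 v) !inE vA /= e_sym.
  by congr (_ + _)%N; apply: eq_card => t; rewrite !inE andbA.
rewrite /arcs (big_setD1 v) //= (eq_bigr _ nbrE) big_split /= addnA addnC.
congr (_ + _)%N; rewrite -addnn; congr (_ + _)%N.
rewrite -sum1_card big_mkcond [RHS]big_mkcond; apply: eq_bigr => u _.
rewrite !inE; case: (eqVneq u v) => [->|_] /=; first by rewrite e_irr andbF.
by case: (u \in A); case: (e v u).
Qed.

(** Deleting one vertex destroys at most [d] edges, that is [2 d] arcs. *)
Lemma arcsD A B d : (forall v, #|nbr A v| <= d)%N -> B \subset A ->
  (arcs A <= arcs (A :\: B) + (d * #|B|).*2)%N.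
Proof.
move=> deg; elim/setU1_ind: B => [|v B vB IH] sBA.
  by rewrite setD0 leq_addr.
have sB : B \subset A by apply: subset_trans sBA; apply: subsetUr.
apply: leq_trans (IH sB) _.
have vA : v \in A :\: B by rewrite inE vB (subsetP sBA) ?setU11.
rewrite (arcsD1 vA) setDDl (setUC B) cardsU1 vB add1n mulnS doubleD addnA
  leq_add2r leq_add2l leq_double.
apply: leq_trans (deg v); apply: subset_leq_card; apply/subsetP => u.
by rewrite !inE => /andP[/andP[_ ->]].
Qed.

Lemma nbrS A B v : A \subset B -> (#|nbr A v| <= #|nbr B v|)%N.
Proof.
move=> /subsetP sAB; apply: subset_leq_card; apply/subsetP => u; rewrite !inE.
by case/andP => /sAB -> ->.
Qed.

(** In the recursion at [v], deleting the neighbours as well only helps independence. Both branches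
    thus contain the factor [Pr (indep (A :\ v))], and its coefficient is bounded below by
    [jensen]. *)
Lemma Pr_indep_ge A k : (arcs A <= k.*2)%N -> (1 - p ^+ 2) ^+ k <= Pr (indep A).
Proof.
have [p_ge0 q_ge0] : 0 <= p /\ 0 <= 1 - p by [].
have q2 : 0 <= 1 - p ^+ 2 by nra.
have q21 : 1 - p ^+ 2 <= 1 by nra.
(* Jensen's inequality for the [d]-th power of a variable equal to [1 - p] with probability [p] and
   to 1 otherwise: its mean is [1 - p ^+ 2]. *)
have jensen d : (1 - p ^+ 2) ^+ d <= (1 - p) + p * (1 - p) ^+ d.
  elim: d => [|d IH]; first by rewrite !expr0 mulr1 subrK.
  rewrite exprS; apply: le_trans (ler_wpM2l q2 IH) _.
  have := exprn_ile1 d q0 (ltac:(lra) : 1 - p <= 1).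
  rewrite (exprS _ d); set y := (1 - p) ^+ d => y1.
  have : 0 <= (1 - p) * p ^+ 2 * (1 - y).
    by rewrite mulr_ge0 ?subr_ge0 // mulr_ge0 ?exprn_ge0.
  by lra.
have [n] := ubnP #|A|; elim: n A k => // n IH A k ltA leA.
have [->|[v vA]] := set_0Vmem A.
  by rewrite (eq_Pr indep0) Pr_predT exprn_ile1.
have ltAv : (#|A :\ v| < n)%N by move: ltA; rewrite (cardsD1 v) vA.
move: leA; rewrite (arcsD1 vA) => leA.
have lek : (#|nbr A v| <= k)%N by lia.
rewrite (Pr_indep_rec vA) -(subnKC lek) exprD.
have := IH (A :\ v) (k - #|nbr A v|)%N ltAv ltac:(lia).
have := @Pr_mono (indep (A :\ v)) (indep (A :\ v :\: nbr A v)) (fun S =>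
  @indep_subset _ _ S (subsetDl _ _)).
have := jensen #|nbr A v|; have := exprn_ge0 #|nbr A v| q0.
have := exprn_ge0 (k - #|nbr A v|)%N q2.
move: (Pr _) (Pr _) (_ ^+ (k - _)%N) => b a x x0.
set y := (1 - p) ^+ _; move=> y0 le_y ab xa.
apply: (@le_trans _ _ ((1 - p + p * y) * a)); first by rewrite ler_pM ?exprn_ge0.
have : p * y * a <= p * y * b by rewrite ler_wpM2l ?mulr_ge0.
by lra.
Qed.

(** Independence gets less likely as the density grows, so a bound computed at [r] serves every
    [p >= r]; this matters because the factor [1 - 4 d r] is useful only for small [r]. The proof is
    again induction by exposing a vertex. *)
Lemma Pr_indep_le A d (r : R) : 0 <= r <= p ->
    (forall v, #|nbr [set: T] v| <= d)%N ->
  Pr (indep A) <= expR (- (r ^+ 2 * (1 - 4 * d%:R * r)) * (arcs A)%:R / 2).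
Proof.
move=> /andP[r0 rp] deg; set lam := r ^+ 2 * _.
have [p_ge0 q_ge0] : 0 <= p /\ 0 <= 1 - p by [].
have [lam_le0|lam_gt0] := leP lam 0.
  apply: le_trans (Pr_le1 _) _; rewrite -expR0 ler_expR.
  by rewrite mulNr mulNr oppr_ge0 -mulrA mulr_le0_ge0 // divr_ge0.
have dr : d%:R * r <= 1 / 4 by move: lam_gt0; rewrite /lam; nra.
have dr0 : 0 <= d%:R * r by rewrite mulr_ge0.
have lam_r : lam <= r ^+ 2 by rewrite /lam; nra.
(* The inductive step for a vertex of degree [k]: deleting it loses [k] edges, and deleting it with
   its neighbours loses at most [d k], so the two induction hypotheses exceed the goal by these
   exponentials. *)
have key k : (k <= d)%N ->
    (1 - p) * expR (k%:R * lam) + p * ((1 - p) ^+ k * expR (d%:R * k%:R * lam)) <= 1.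
  rewrite -(ler_nat R); have : 0 <= k%:R :> R by [].
  set K : R := k%:R => K0; set D : R := d%:R in dr dr0 *; move=> KD.
  have Kr : K * r <= D * r by apply: ler_wpM2r.
  have Dlam : D * lam <= r / 4.
    apply: (@le_trans _ _ (D * r ^+ 2)); first by apply: ler_wpM2l => //; lra.
    by rewrite expr2 mulrA; nra.
  have le_quad (x : R) : x <= 1 / 2 -> expR x <= 1 + x + 2 * x ^+ 2.
    move=> x12; rewrite -[leLHS]invrK -expRN -[leRHS]invrK.
    rewrite lef_pV2 ?posrE ?invr_gt0 ?expR_gt0 //; last by nra.
    apply: le_trans (expR_ge1Dx _); rewrite -div1r ler_pdivrMr; nra.
  have le_b : (1 - p) ^+ k * expR (D * K * lam) <= expR (- (K * (r - D * lam))).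
    apply: (@le_trans _ _ (expR (- r) ^+ k * expR (D * K * lam))).
      apply: ler_wpM2r; first exact: expR_ge0.
      apply: lerXn2r; rewrite ?nnegrE ?expR_ge0 //.
      by apply: le_trans (expR_ge1Dx _); lra.
    by rewrite -expRM_natl -expRD ler_expR -/K; nra.
  have KDlam : K * (D * lam) <= K * (r / 4) by apply: ler_wpM2l.
  have Ku : 0 <= K * (r - D * lam) by apply: mulr_ge0 => //; nra.
  have le_b' := le_quad (- (K * (r - D * lam))) ltac:(lra).
  have Klam : K * lam <= D * r ^+ 2 by apply: ler_pM => //; lra.
  have le_a := le_quad (K * lam) ltac:(nra).
  have a1 : 1 <= expR (K * lam) by rewrite -expR0 ler_expR; nra.
  have b1 : expR (- (K * (r - D * lam))) <= 1 by rewrite -expR0 ler_expR; nra.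
  (* The first exponential is at least 1 and the second at most 1, so moving weight from the second
     to the first, from [p] down to [r], increases the average. *)
  apply: (@le_trans _ _ ((1 - r) * expR (K * lam) + r * expR (- (K * (r - D * lam))))).
    by move: (expR _) (expR _) (expR _) ((1 - p) ^+ k) le_b a1 b1 => *; nra.
  set u := K * (r - D * lam) in Ku le_b' *; set y := K * lam in Klam le_a *.
  (* The bound [r <= 1 / 4] follows from [d r <= 1 / 4] only if [d >= k >= 1]. *)
  have [k0|k_gt0] := posnP k.
    have K_0 : K = 0 by rewrite /K k0.
    by rewrite /y /u K_0 !mul0r oppr0 expR0; lra.
  have r14 : r <= 1 / 4.
    apply: le_trans dr; rewrite -[leLHS]mul1r; apply: ler_wpM2r => //.
    by apply: le_trans KD; rewrite /K ler1n.
  have y0 : 0 <= y by rewrite mulr_ge0 // ltW.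
  have D0 : 0 <= D by apply: le_trans KD.
  have KDl0 : 0 <= K * (D * lam) by do 2!apply: mulr_ge0 => //; apply: ltW.
  have u_le : u <= K * r by rewrite /u; lra.
  (* [X] is the unit of error. The main terms [K r^2] of [y] and [r u] cancel; the [- 4 X] in [y]
     pays for [2 y^2 <= X / 2], for the loss [X] in [r u], and for [2 r u^2 <= 2 X]. *)
  set X := K * D * r ^+ 3; have X0 : 0 <= X by rewrite !mulr_ge0 ?exprn_ge0.
  have ru2 : r * u ^+ 2 <= X.
    have : u * u <= (K * r) * (D * r) by apply: ler_pM => //; lra.
    by move/(ler_wpM2l r0); rewrite /X; lra.
  have yX : y = K * r ^+ 2 - 4 * X by rewrite /y /X /lam -/D; ring.
  have y2 : y ^+ 2 <= X / 4.
    apply: (@le_trans _ _ (r * X)); last by nra.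
    have : y * y <= (K * r ^+ 2) * (D * r ^+ 2) by apply: ler_pM => //; lra.
    by rewrite /X; lra.
  have ru : K * r ^+ 2 - X <= r * u.
    have : K * (D * lam) <= K * (D * r ^+ 2) by rewrite !ler_wpM2l.
    by move/(ler_wpM2l r0); rewrite /u /X; lra.
  have := ler_wpM2l (ltac:(lra) : 0 <= 1 - r) le_a.
  have := ler_wpM2l r0 le_b'.
  have : 0 <= r * y by rewrite mulr_ge0.
  have : 0 <= r * y ^+ 2 by rewrite mulr_ge0 ?exprn_ge0.
  by lra.
have [n] := ubnP #|A|; elim: n A => // n IH A ltA.
have [->|[v vA]] := set_0Vmem A.
  by rewrite (eq_Pr indep0) Pr_predT /arcs big_set0 mulr0 mul0r expR0.
have ltAv : (#|A :\ v| < n)%N by move: ltA; rewrite (cardsD1 v) vA.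
set N := nbr A v; set k := #|N|.
have kd : (k <= d)%N by apply: leq_trans (deg v); apply/nbrS/subsetT.
have vN : v \in A :\: N by rewrite !inE vA e_irr.
have NvE : A :\ v :\: N = (A :\: N) :\ v by rewrite !setDDl setUC.
have ltAN : (#|A :\ v :\: N| < n)%N.
  by apply: leq_ltn_trans ltAv; apply/subset_leq_card/subsetDl.
have arcs1 := arcsD1 vA.
have arcs2 : (arcs A <= arcs (A :\ v :\: N) + (d * k).*2)%N.
  apply: leq_trans (arcsD (B := N) (d := d) _ _) _.
  - by move=> u; apply: leq_trans (deg u); apply/nbrS/subsetT.
  - by apply/subsetP => u; rewrite !inE => /andP[].
  (* Once its neighbours are gone, [v] is isolated, so its own deletion costs no arc. *)
  rewrite NvE (arcsD1 vN) (_ : nbr _ _ = set0) ?cards0 ?addn0 //.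
  apply/setP => u; rewrite !inE; apply/negbTE/negP.
  by case/andP => /andP[/negP uN uA] vu; apply: uN; rewrite uA.
set E := expR _; have E0 : 0 < E by apply: expR_gt0.
have le1 : Pr (indep (A :\ v)) <= E * expR (k%:R * lam).
  apply: le_trans (IH _ ltAv) _; rewrite -expRD ler_expR arcs1 -/N -/k.
  by rewrite natrD -mul2n natrM; lra.
have le2 : Pr (indep (A :\ v :\: N)) <= E * expR (d%:R * k%:R * lam).
  apply: le_trans (IH _ ltAN) _; rewrite -expRD ler_expR.
  move: arcs2; rewrite -(ler_nat R) natrD -mul2n !natrM; set a := (arcs _)%:R.
  by set b := (arcs _)%:R => /(ler_wpM2l (ltW lam_gt0)); lra.
rewrite (Pr_indep_rec vA) -/N -/k; apply: le_trans (_ : E * 1 <= _); last first.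
  by rewrite mulr1.
apply: le_trans (ler_wpM2l (ltW E0) (key k kd)); rewrite mulrDr; apply: lerD.
  by rewrite [leRHS]mulrCA; apply: ler_wpM2l.
by rewrite [leRHS]mulrCA ler_wpM2l // [leRHS]mulrCA ler_wpM2l ?exprn_ge0.
Qed.

End IndependentSets.
End RandomSubset.

(** * The second moment method *)

Section SecondMoment.
Variables (R : realType) (T I : finType) (p : R).
Hypothesis p01 : 0 <= p <= 1.
Variables (P : pred I) (E : I -> pred {set T}) (rho : R).
Hypothesis rho0 : 0 <= rho.
Hypothesis corr : forall i j, P i -> P j -> i != j ->
  Pr p (fun S => E i S && E j S) <= rho * (Pr p (E i) * Pr p (E j)).

(** Chebyshev's inequality for the number [X] of events that occur. Diagonal pairs contribute [M] to
    the second moment since indicators are idempotent, and the other pairs at most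
    [rho * M ^+ 2]. *)
Lemma Pr_second_moment : let M := \sum_(i | P i) Pr p (E i) in 0 < M ->
  Pr p (fun S => ~~ [exists i, P i && E i S]) <= M^-1 + rho - 1.
Proof.
move=> M M0; pose X S : R := \sum_(i | P i) (E i S)%:R.
have X0 S : ~~ [exists i, P i && E i S] -> X S = 0.
  move=> /existsPn none; apply: big1 => i Pi.
  by have := none i; rewrite Pi /= => /negbTE ->.
have EX : \sum_S X S * weight p S = M.
  rewrite /M; under [RHS]eq_bigr do rewrite PrE.
  by rewrite [RHS]exchange_big; apply: eq_bigr => S _; rewrite mulr_suml.
have EX2 : \sum_S X S ^+ 2 * weight p S <= M + rho * M ^+ 2.
  have -> : \sum_S X S ^+ 2 * weight p S =
      \sum_(i | P i) \sum_(j | P j) Pr p (fun S => E i S && E j S).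
    under [RHS]eq_bigr do under eq_bigr do rewrite PrE.
    under [RHS]eq_bigr do rewrite exchange_big.
    rewrite [RHS]exchange_big; apply: eq_bigr => S _ /=.
    rewrite expr2 -mulrA mulr_suml; apply: eq_bigr => i _.
    rewrite mulr_suml mulr_sumr; apply: eq_bigr => j _.
    by rewrite -mulnb natrM mulrA.
  have -> : M + rho * M ^+ 2 = \sum_(i | P i) (Pr p (E i) +
      \sum_(j | P j) rho * (Pr p (E i) * Pr p (E j))).
    rewrite big_split /=; congr (_ + _); rewrite expr2 {1}/M mulr_suml mulr_sumr.
    by apply: eq_bigr => i _; rewrite !mulr_sumr.
  apply: ler_sum => i Pi; rewrite (bigD1 i) //=.
  apply: lerD; first by apply: Pr_mono => // S /andP[].
  rewrite [leRHS](bigD1 i) //=.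
  apply: ler_wpDl; first by rewrite !mulr_ge0 ?Pr_ge0.
  by apply: ler_sum => j /andP[Pj ji]; rewrite corr // eq_sym.
have var : Pr p (fun S => ~~ [exists i, P i && E i S]) * M ^+ 2 <=
    M + rho * M ^+ 2 - M ^+ 2.
  apply: (@le_trans _ _ (\sum_S (X S - M) ^+ 2 * weight p S)).
    rewrite PrE mulr_suml; apply: ler_sum => S _; rewrite mulrAC.
    apply: ler_wpM2r; first exact: weight_ge0.
    case: (boolP (~~ _)) => [/X0 ->|_]; last by rewrite mul0r sqr_ge0.
    by rewrite mul1r sub0r sqrrN.
  have -> : \sum_S (X S - M) ^+ 2 * weight p S =
      \sum_S X S ^+ 2 * weight p S - M *+ 2 * (\sum_S X S * weight p S) +
      M ^+ 2 * \sum_(S : {set T}) weight p S.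
    rewrite !mulr_sumr -sumrB -big_split /=; apply: eq_bigr => S _.
    by ring.
  have -> : \sum_(S : {set T}) weight p S = 1 by rewrite -(Pr_predT T p).
  by rewrite EX; nra.
rewrite -(ler_pM2r (exprn_gt0 2 M0)); apply: le_trans var _.
by rewrite le_eqVlt; apply/orP; left; apply/eqP; field; rewrite gt_eqF.
Qed.

End SecondMoment.

(** * Diameter at most 2 as a covering property of the generating set *)

Section CayleyDiameter.
Variables (R : realType) (gT : finGroupType).
Implicit Types (S : {set gT}) (x g h : gT).

Definition sym_closure S : {set gT} := [set g | (g \in S) || (g^-1 \in S)%g].

Definition reach2 S x : bool :=
  (x \in sym_closure S) ||
  [exists s in sym_closure S, exists t in sym_closure S, (s * t == x)%g].

(** Lengths are integers: if no walk has length at most 2, all have length at least 3, and so does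
    the infimum. *)
Lemma graph_dist_le2 (T : finType) (e : rel T) (x y : T) :
  (graph_dist R e x y <= 2%:E)%E ->
  exists s, [/\ path e x s, last x s = y & (size s <= 2)%N].
Proof.
move=> le2; apply: contrapT => none.
suff : (3%:E <= graph_dist R e x y)%E.
  by move=> /le_trans/(_ le2); rewrite lee_fin ler_nat.
apply: le_ereal_inf_tmp => _ [s [es ls] <-]; rewrite lee_fin ler_nat ltnNge.
by apply/negP => s2; apply: none; exists s.
Qed.

Lemma cayleyE S g h :
  cayley S g h = (g != h) && ((h * g^-1)%g \in sym_closure S).
Proof. by rewrite /cayley inE invMg invgK. Qed.

(** Right translations are automorphisms, so only the quotient [h * g^-1] of two vertices
    matters. *)
Lemma diameter_cayley_le2 S :
  (diameter R (cayley S) <= 2%:E)%E = [forall x, (x != 1%g) ==> reach2 S x].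
Proof.
apply/idP/forallP => [diam2 x|reach].
  apply/implyP => x1.
  have : (graph_dist R (cayley S) 1%g x <= 2%:E)%E.
    by apply: le_trans diam2; apply: ereal_sup_ubound; exists (1%g, x).
  move=> /graph_dist_le2[[|a [|b [|c s]]]] [] //=.
  - by move=> _ x_eq; rewrite -x_eq eqxx in x1.
  - rewrite andbT cayleyE => /andP[_]; rewrite invg1 mulg1 => aS <- _.
    by rewrite /reach2 aS.
  rewrite andbT !cayleyE invg1 mulg1 => /andP[/andP[_ aS] /andP[_ baS]] <- _.
  apply/orP; right; apply/exists_inP; exists (b * a^-1)%g => //.
  by apply/exists_inP; exists a; rewrite ?mulgKV.
apply: ge_ereal_sup => _ [[g h] _ <-] /=.
suff [s [gs ls s2]] : exists s,
    [/\ path (cayley S) g s, last g s = h & (size s <= 2)%N].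
  apply: (@le_trans _ _ ((size s)%:R%:E)); last by rewrite lee_fin ler_nat.
  by apply: ereal_inf_lbound; exists s.
(* The quotient may be 1, which gives no edge; the empty walk then replaces it. *)
have edge g' h' : (h' * g'^-1)%g \in sym_closure S ->
    exists s, [/\ path (cayley S) g' s, last g' s = h' & (size s <= 1)%N].
  have [<- _|gh ghS] := eqVneq g' h'; first by exists [::].
  by exists [:: h']; split; rewrite //= cayleyE gh ghS.
have [<-|gh] := eqVneq g h; first by exists [::].
have := reach (h * g^-1)%g; rewrite -eq_mulgV1 eq_sym gh => /orP[].
  by case/edge => s [gs ls s1]; exists s; split => //; apply: leqW.
case/exists_inP => s sS /exists_inP[t tS /eqP st].
have [s1 [gs1 ls1 len1]] := edge g (t * g)%g ltac:(by rewrite mulgK).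
have [|s2 [gs2 ls2 len2]] := edge (t * g)%g h.
  by rewrite invMg mulgA -st mulgK.
exists (s1 ++ s2); rewrite cat_path last_cat ls1 gs1 gs2 ls2 size_cat.
by split => //; exact: leq_add len1 len2.
Qed.

Lemma Pr_cayley_diam_le2 (p : R) :
  Pr_cayley p (fun e : rel gT => (diameter R e <= 2%:E)%E) =
  Pr p (fun S => ~~ [exists x, (x != 1%g) && ~~ reach2 S x]).
Proof.
apply: eq_bigl => S; rewrite diameter_cayley_le2 negb_exists.
by apply: eq_forallb => x; case: (x != 1%g); case: (reach2 S x).
Qed.

Lemma Pr_cayley_diam_gt2 (p : R) :
  Pr_cayley p (fun e : rel gT => (2%:E < diameter R e)%E) =
  Pr p (fun S => [exists x, (x != 1%g) && ~~ reach2 S x]).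
Proof.
apply: eq_bigl => S; rewrite ltNge diameter_cayley_le2 negb_forall.
by apply: eq_existsb => x; rewrite negb_imply.
Qed.

End CayleyDiameter.

(** * The graph [H_x] of pairs whose signed products give [x] *)

Section ProductGraph.
Import mathcomp.boot.fintype mathcomp.boot.finset.
Variable gT : finGroupType.
Implicit Types (x s t : gT) (S : {set gT}).
Local Open Scope group_scope.

Definition signed_prod x s t : bool :=
  [|| s * t == x, s * t^-1 == x, s^-1 * t == x | s^-1 * t^-1 == x].

(* If two elements of S are adjacent for x, then x is a product of two elements
   of the symmetric closure of S. *)
Definition prod_adj x : rel gT :=
  fun s t => (s != t) && (signed_prod x s t || signed_prod x t s).

Lemma prod_adj_sym x : symmetric (prod_adj x).
Proof. by move=> s t; rewrite /prod_adj eq_sym orbC. Qed.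

Lemma prod_adj_irr x : irreflexive (prod_adj x).
Proof. by move=> s; rewrite /prod_adj eqxx. Qed.

Lemma nreach2_indep x S : ~~ reach2 S x -> indep (prod_adj x) [set: gT] S.
Proof.
have cl s : s \in S -> (s \in sym_closure S) * (s^-1 \in sym_closure S).
  by move=> sS; rewrite !inE invgK sS orbT.
have reach s t : s \in sym_closure S -> t \in sym_closure S ->
    s * t == x -> reach2 S x.
  move=> sS tS stx; apply/orP; right; apply/exists_inP; exists s => //.
  by apply/exists_inP; exists t.
move=> nreach; apply/indepP => s t _ sS _ tS; apply: contra nreach.
by case/andP => _ /orP[] /or4P[]; apply: reach; rewrite ?(cl _ sS) ?(cl _ tS).
Qed.

(** Each of the eight signed products, four in either order, determines [s] from [x] and [t]. *)
Lemma prod_adj_deg x t : (#|nbr (prod_adj x) [set: gT] t| <= 8)%N.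
Proof.
pose l := [:: x * t^-1; x * t; t * x^-1; t^-1 * x^-1;
              t^-1 * x; x^-1 * t; t * x; x^-1 * t^-1].
apply: (@leq_trans (size l)) => //; apply: leq_trans (card_size l).
apply: subset_leq_card; apply/subsetP => s; rewrite !inE /= => /andP[_].
case/orP => /or4P[] /eqP <-; rewrite !invMg ?invgK;
  by rewrite ?mulKg ?mulKVg ?mulgK ?mulgKV eqxx ?orbT.
Qed.

Lemma mem_nbr_prod_adj x t s : s != t ->
  s \in [:: x * t; x^-1 * t; x * t^-1; t * x] ->
  s \in nbr (prod_adj x) [set: gT] t.
Proof.
move=> st; rewrite !inE /= /prod_adj /signed_prod (eq_sym t) st /=.
case/or4P => /eqP ->; rewrite ?invMg ?invgK;
  by rewrite ?mulKg ?mulKVg ?mulgK ?mulgKV eqxx ?orbT.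
Qed.

Lemma mulg_neqr x t : x != 1 -> x * t != t.
Proof. by move=> x1; rewrite -{2}[t]mul1g (inj_eq (mulIg t)). Qed.

Lemma nbr_ge1 x t : x != 1 -> (1 <= #|nbr (prod_adj x) [set: gT] t|)%N.
Proof.
move=> x1; apply/card_gt0P; exists (x * t); apply: mem_nbr_prod_adj; rewrite ?mem_head //.
exact: mulg_neqr.
Qed.

Lemma nbr_ge2 x t a b : a != b -> a != t -> b != t ->
  a \in [:: x * t; x^-1 * t; x * t^-1; t * x] ->
  b \in [:: x * t; x^-1 * t; x * t^-1; t * x] ->
  (2 <= #|nbr (prod_adj x) [set: gT] t|)%N.
Proof.
move=> ab a_t b_t ax bx; apply: (@leq_trans #|[set a; b]|).
  by rewrite cards2 ab.
apply/subset_leq_card/subsetP => c; rewrite !inE => /orP[]/eqP->.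
  by have := mem_nbr_prod_adj a_t ax; rewrite !inE.
by have := mem_nbr_prod_adj b_t bx; rewrite !inE.
Qed.

(** Every [t] has the two neighbours [x t] and [x^-1 t], distinct because [x] differs from its
    inverse. *)
Lemma arcs_not_involution x : x * x != 1 ->
  (#|gT|.*2 <= arcs (prod_adj x) [set: gT])%N.
Proof.
move=> xx; rewrite /arcs -muln2 -cardsT -sum_nat_const; apply: leq_sum => t _.
have x1 : x != 1 by apply: contraNneq xx => ->; rewrite mulg1.
apply: (@nbr_ge2 _ _ (x * t) (x^-1 * t));
  rewrite ?mulg_neqr ?invg_eq1 ?inE ?eqxx ?orbT //.
by rewrite (inj_eq (mulIg t)) eq_mulgV1 invgK.
Qed.

End ProductGraph.

(* K plays the rotations and Z the elementary abelian factor of C_2^n x D_2m,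
   with L = 2^n. *)
Record dihedral_like (gT : finGroupType) (K : {group gT}) (Z : {set gT})
    (L : nat) : Prop := DihedralLike {
  dl_cardC : #|~: K| = #|K|;
  dl_invol : forall t, t \notin K -> (t * t = 1)%g;
  dl_sqK : forall y, (#|[set t in K | t * t == y]%g| <= L.*2)%N;
  dl_cardZ : #|Z| = L;
  dl_Z1 : (1 \in Z)%g;
  dl_Zcent : forall z t, z \in Z -> (z * t = t * z)%g;
  dl_ZM : forall z z', z \in Z -> z' \in Z -> (z * z' \in Z)%g;
  dl_Zinvol : forall z, z \in Z -> (z * z = 1)%g;
  dl_Zsq : forall t, (t * t \in Z -> t * t = 1)%g
}.

(** * Edge counts for [H_x] in dihedral-like groups *)

Section DihedralLike.
Import mathcomp.boot.fintype mathcomp.boot.finset.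
Variables (gT : finGroupType) (K : {group gT}) (Z : {set gT}) (L : nat).
Local Open Scope group_scope.
Hypothesis dl : dihedral_like K Z L.
Implicit Types (x y z s t : gT) (S : {set gT}).

Let cardK := dl_cardC dl.
Let invol := dl_invol dl.
Let sqK := dl_sqK dl.

Let invol_inv t : t \notin K -> t^-1 = t.
Proof. by move=> /invol tt; apply/eqP; rewrite eq_invg_mul tt. Qed.

Lemma card_half : #|gT| = (#|K|.*2)%N.
Proof. by rewrite -addnn -{2}cardK cardsC. Qed.

Lemma mulg_notin x t : x \notin K -> t \notin K -> x * t \in K.
Proof.
move=> xK tK; have : t \in x *: K.
  have -> : x *: K = ~: K; last by rewrite inE.
  apply/eqP; rewrite eqEcard card_lcoset cardK leqnn andbT.
  apply/subsetP => _ /lcosetP[k kK ->]; rewrite inE.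
  by apply: contra xK => xkK; rewrite -(groupMr x kK).
by rewrite mem_lcoset (invol_inv xK).
Qed.

Let card_sum (B : {set gT}) : #|B| = (\sum_(t in [set: gT]) (t \in B))%N.
Proof.
rewrite -sum1_card big_mkcond [RHS]big_mkcond; apply: eq_bigr => t _.
by rewrite inE; case: (t \in B).
Qed.

(** A rotation [t] has neighbours [x t] and [x t^-1], which coincide only if [t^2 = 1]; a reflection
    [t] has [x t] and [t x], which coincide only if [(x t)^2 = 1]. By [mulg_notin] both exceptional
    sets consist, up to translation, of square roots of 1 in [K]. *)
Lemma arcs_notin x : x \notin K ->
  (#|gT|.*2 <= arcs (prod_adj x) [set: gT] + L.*2.*2)%N.
Proof.
move=> xK; have x1 : x != 1 by apply: contraNneq xK => ->.
pose B1 := [set t in K | t * t == 1].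
pose B2 := [set t | (t \notin K) && ((x * t) * (x * t) == 1)].
have card2 : (#|B2| <= L.*2)%N.
  rewrite -(card_imset _ (mulgI x)); apply: leq_trans (sqK 1).
  apply/subset_leq_card/subsetP => _ /imsetP[t + ->].
  by rewrite !inE => /andP[tK ->]; rewrite mulg_notin.
apply: (@leq_trans (arcs (prod_adj x) [set: gT] + (#|B1| + #|B2|))); last first.
  by rewrite leq_add2l -addnn leq_add ?sqK.
rewrite (card_sum B1) (card_sum B2) -!big_split -muln2 -cardsT -sum_nat_const.
apply: leq_sum => t _ /=; rewrite !inE.
have deg1 := nbr_ge1 t x1.
have [tK|tK] := boolP (t \in K) => /=.
  have [tt|tt] := eqVneq (t * t) 1; first by rewrite /= addn0 addn1 ltnS.
  rewrite /= !addn0; apply: (@nbr_ge2 _ _ _ (x * t) (x * t^-1)).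
  - by rewrite (inj_eq (mulgI x)) eq_mulgV1 invgK.
  - exact: mulg_neqr.
  - by apply: contraNneq xK => /(canRL (mulgK _)); rewrite invgK => ->; rewrite groupM.
  - by rewrite !inE eqxx.
  - by rewrite !inE eqxx !orbT.
have [xt|xt] := eqVneq (x * t * (x * t)) 1; first by rewrite /= add0n addn1 ltnS.
rewrite /= !addn0; apply: (@nbr_ge2 _ _ _ (x * t) (t * x)).
- apply: contraNneq xt => xt; rewrite {2}xt mulgA -(mulgA x t t) (invol tK).
  by rewrite mulg1 (invol xK).
- exact: mulg_neqr.
- by rewrite -{2}[t]mulg1 (inj_eq (mulgI t)).
- by rewrite !inE eqxx.
- by rewrite !inE eqxx !orbT.
Qed.

(** Every [t] has the neighbour [x t]. A rotation has the second neighbour [x t^-1], unless this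
    equals [x t] (when [t^2 = 1]) or [t] itself (when [t^2 = x]). *)
Lemma arcs_involution x : x \in K -> x != 1 -> x * x = 1 ->
  (3 * #|K| <= arcs (prod_adj x) [set: gT] + L.*2.*2)%N.
Proof.
move=> xK x1 xx.
pose B y := [set t in K | t * t == y].
apply: (@leq_trans (arcs (prod_adj x) [set: gT] + (#|B 1%g| + #|B x|))); last first.
  by rewrite leq_add2l -addnn leq_add ?sqK.
have -> : (3 * #|K| = \sum_(t in [set: gT]) (1 + (t \in K)))%N.
  by rewrite big_split /= -card_sum sum1_card cardsT card_half -mul2n -mulSnr.
rewrite (card_sum (B 1%g)) (card_sum (B x)) -!big_split.
apply: leq_sum => t _ /=; rewrite !inE.
have deg1 := nbr_ge1 t x1.
have [tK|tK] := boolP (t \in K) => /=; last by rewrite !addn0.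
have [tt|tt] := eqVneq (t * t) 1.
  by rewrite /= addnA; apply: leq_trans (leq_addr _ _); apply: leq_add.
have [ttx|ttx] := eqVneq (t * t) x; first by rewrite /= add0n; apply: leq_add.
rewrite /= !addn0; apply: (@nbr_ge2 _ _ _ (x * t) (x * t^-1)).
- by rewrite (inj_eq (mulgI x)) eq_mulgV1 invgK.
- exact: mulg_neqr.
- by apply: contraNneq ttx => /(canRL (mulgK _)); rewrite invgK => ->.
- by rewrite !inE eqxx.
- by rewrite !inE eqxx !orbT.
Qed.

Let Zcent := dl_Zcent dl.
Let ZM := dl_ZM dl.
Let Zinvol := dl_Zinvol dl.
Let Zsq := dl_Zsq dl.

Let Zinv z : z \in Z -> z^-1 = z.
Proof. by move=> /Zinvol tt; apply/eqP; rewrite eq_invg_mul tt. Qed.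

(** As [z] is central and its own inverse, the eight relations collapse to two. *)
Lemma prod_adj_central z s t : z \in Z ->
  prod_adj z s t -> s = z * t \/ s = z * t^-1.
Proof.
move=> zZ /andP[_].
case/orP => /or4P[] /eqP stz.
- by right; rewrite -stz mulgK.
- by left; rewrite -stz mulgKV.
- by left; apply: invg_inj; rewrite invMg (Zinv zZ) -Zcent // -stz -mulgA mulgV mulg1.
- by right; apply: invg_inj; rewrite invMg invgK (Zinv zZ) -Zcent // -stz mulgKV.
- by right; rewrite Zcent // -stz mulKg.
- by left; rewrite -[s]invgK -(Zinv zZ) -stz invMg invgK mulgKV.
- by left; rewrite Zcent // -stz mulKVg.
- by right; rewrite -[s]invgK -(Zinv zZ) -stz invMg !invgK mulgK.
Qed.

(** The upper bound matching [arcs_involution]: for a reflection, [t^-1 = t] and the two candidate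
    neighbours merge. *)
Lemma arcs_central z : z \in Z -> (arcs (prod_adj z) [set: gT] <= 3 * #|K|)%N.
Proof.
move=> zZ; have -> : (3 * #|K| = \sum_(t in [set: gT]) (1 + (t \in K)))%N.
  by rewrite big_split /= -card_sum sum1_card cardsT card_half -mul2n -mulSnr.
apply: leq_sum => t _.
have sub : nbr (prod_adj z) [set: gT] t \subset [set z * t; z * t^-1].
  apply/subsetP => s; rewrite !inE /= prod_adj_sym => /(prod_adj_central zZ).
  by case=> ->; rewrite eqxx ?orbT.
apply: leq_trans (subset_leq_card sub) _; rewrite cards2.
have [tK|tK] := boolP (t \in K); first by case: (_ != _).
by rewrite (invol_inv tK) eqxx.
Qed.

(** A converse to [nreach2_indep]. Apart from [z] lying in [S], the only products invisible to the
    graph use one element twice; they are 1 or squares, and 1 is the only square in [Z]. *)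
Lemma indep_nreach2 z S : z \in Z -> z != 1 -> z \notin S ->
  indep (prod_adj z) [set: gT] S -> ~~ reach2 S z.
Proof.
move=> zZ z1 zS /indepP ind; rewrite negb_or !inE (Zinv zZ) orbb zS /=.
apply/negP => /exists_inP[s sS /exists_inP[t tS /eqP stz]].
have cl u : u \in sym_closure S -> exists2 v, v \in S & u = v \/ u = v^-1.
  by rewrite inE => /orP[] uS; [exists u|exists u^-1]; rewrite ?invgK; auto.
have [s' s'S es] := cl s sS; have [t' t'S et] := cl t tS.
have [est|nst] := eqVneq s' t'.
  have [st1|ss|ss] : [\/ s * t = 1, s * t = s' * s' | s * t = s'^-1 * s'^-1].
  - case: es et => -> [] ->; rewrite -est; last by apply: Or33.
    + exact: Or32.
    + by apply: Or31; rewrite mulgV.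
    + by apply: Or31; rewrite mulVg.
  - by move: z1; rewrite -stz st1 eqxx.
  - by move: z1; rewrite -stz ss Zsq ?eqxx // -ss stz.
  - by move: z1; rewrite -stz ss Zsq ?eqxx // -ss stz.
have := ind s' t' (in_setT _) s'S (in_setT _) t'S; rewrite /prod_adj nst /=.
rewrite /signed_prod -stz.
by case: es et => -> [] ->; rewrite ?invgK eqxx ?orbT.
Qed.

Definition adj2 z z' : rel gT := fun s t => prod_adj z s t || prod_adj z' s t.

Lemma adj2_sym z z' : symmetric (adj2 z z').
Proof. by move=> s t; rewrite /adj2 !(prod_adj_sym _ s). Qed.

Lemma adj2_irr z z' : irreflexive (adj2 z z').
Proof. by move=> s; rewrite /adj2 !prod_adj_irr. Qed.

Let nbr2 z z' t : nbr (adj2 z z') [set: gT] t =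
  nbr (prod_adj z) [set: gT] t :|: nbr (prod_adj z') [set: gT] t.
Proof. by apply/setP => s; rewrite !inE. Qed.

Lemma adj2_deg z z' t : (#|nbr (adj2 z z') [set: gT] t| <= 16)%N.
Proof.
rewrite nbr2; apply: leq_trans (leq_card_setU _ _) _.
exact: (leq_add (prod_adj_deg z t) (prod_adj_deg z' t)).
Qed.

(** A common neighbour of [t] would be both [z t^{+-1}] and [z' t^{+-1}]. Then [z z'] is 1 or a
    square, hence 1, and [z = z']. *)
Lemma arcs_adj2 z z' : z \in Z -> z' \in Z -> z != z' ->
  (arcs (adj2 z z') [set: gT] =
   arcs (prod_adj z) [set: gT] + arcs (prod_adj z') [set: gT])%N.
Proof.
move=> zZ z'Z zz'; rewrite /arcs -big_split; apply: eq_bigr => t _ /=.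
rewrite nbr2 cardsU (_ : _ :&: _ = set0) ?cards0 ?subn0 //.
apply/setP => s; rewrite !inE /=; apply/negbTE/negP => /andP[].
rewrite ![prod_adj _ t s]prod_adj_sym.
have sq t1 t2 : (t1 = t \/ t1 = t^-1) -> (t2 = t \/ t2 = t^-1) ->
    z * t1 = z' * t2 -> False.
  move=> e1 e2 /(canRL (mulKg _)); rewrite (Zinv zZ) mulgA => e12.
  have e12' : z * z' = t1 * t2^-1 by rewrite e12 mulgK.
  have := ZM zZ z'Z; rewrite e12'.
  suff : t1 * t2^-1 \in Z -> t1 * t2^-1 = 1.
    move=> H /H; rewrite -e12' => /eqP; rewrite -eq_invg_mul (Zinv zZ).
    by rewrite (negbTE zz').
  by case: e1 e2 => -> [] ->; rewrite ?invgK ?mulgV ?mulVg //; apply: Zsq.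
move=> /(prod_adj_central zZ) e1 /(prod_adj_central z'Z) e2.
by case: e1 => e1; case: e2; rewrite e1; apply: sq; auto.
Qed.

End DihedralLike.

(** * Probability bounds for unreachable elements *)

Section DihedralLikeProbability.
Import mathcomp.boot.fintype mathcomp.boot.finset.
Variables (R : realType) (gT : finGroupType) (K : {group gT}) (Z : {set gT}).
Variables (L : nat) (p : R).
Hypotheses (dl : dihedral_like K Z L) (p01 : 0 <= p <= 1).
Local Notation N := (#|gT|%:R : R).
Implicit Types (x z : gT) (S : {set gT}).

Lemma natr_card_half : #|K|%:R = N / 2.
Proof. by rewrite (card_half dl) -mul2n natrM mulrC mulKf. Qed.

Lemma Pr_nreach2_le r x (a : R) : 0 <= r <= p -> 32 * r <= 1 ->
    2 * a <= (arcs (prod_adj x) [set: gT])%:R ->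
  Pr p (fun S => ~~ reach2 S x) <= expR (- (r ^+ 2 * (1 - 32 * r)) * a).
Proof.
move=> r0p r32 le_a.
apply: le_trans (Pr_mono p01 (fun S => @nreach2_indep _ x S)) _.
apply: le_trans (Pr_indep_le p01 (@prod_adj_sym _ x) (@prod_adj_irr _ x) _ r0p
  (prod_adj_deg x)) _.
(* The 32 is the 4 of [Pr_indep_le] times the degree bound 8. *)
rewrite ler_expR -[4 * 8]/(4%:R * 8%:R) -natrM !mulNr lerN2 -mulrA.
apply: ler_wpM2l; last by rewrite ler_pdivlMr ?ltr0n // mulrC.
by rewrite mulr_ge0 ?sqr_ge0 ?subr_ge0.
Qed.

(** Union bound over two classes: the at most [2 L] rotations of square 1, with about [3 N / 4]
    edges, and all other elements, with about [N]. *)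
Lemma Pr_exists_nreach2_le r : 0 <= r <= p -> 32 * r <= 1 ->
  Pr p (fun S => [exists x, (x != 1%g) && ~~ reach2 S x]) <=
  N * expR (- (r ^+ 2 * (1 - 32 * r)) * (N - 2 * L%:R)) +
  2 * L%:R * expR (- (r ^+ 2 * (1 - 32 * r)) * (3 / 4 * N - 2 * L%:R)).
Proof.
move=> r0p r32; apply: le_trans (Pr_exists_le p01 _ _) _.
pose B := [set t in K | t * t == 1]%g.
rewrite (bigID (mem B)) /= addrC; apply: lerD.
- apply: (@le_trans _ _ (\sum_(x : gT)
      expR (- (r ^+ 2 * (1 - 32 * r)) * (N - 2 * L%:R)))).
    rewrite big_mkcond; apply: ler_sum => x _.
    case: ifP => [/andP[x1 xB]|_]; last exact: expR_ge0.
    apply: Pr_nreach2_le => //.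
    have [xx|xx] := eqVneq (x * x)%g 1%g.
      have /(arcs_notin dl) : x \notin K by move: xB; rewrite !inE xx eqxx andbT.
      by rewrite -(ler_nat R) natrD -!mul2n !natrM; lra.
    have := arcs_not_involution xx.
    by rewrite -(ler_nat R) -!mul2n !natrM; have : 0 <= L%:R :> R by []; lra.
  by rewrite sumr_const -[leLHS]mulr_natl.
apply: (@le_trans _ _ (\sum_(x in B)
    expR (- (r ^+ 2 * (1 - 32 * r)) * (3 / 4 * N - 2 * L%:R)))).
  rewrite big_mkcond [leRHS]big_mkcond; apply: ler_sum => x _.
  have [xB|xB] := boolP (x \in B); last by rewrite andbF.
  rewrite andbT; case: ifP => [x1|_]; last exact: expR_ge0.
  apply: Pr_nreach2_le => //; move: xB; rewrite !inE => /andP[xK /eqP xx].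
  have := arcs_involution dl xK x1 xx.
  by rewrite -(ler_nat R) natrD -!mul2n !natrM natr_card_half; lra.
rewrite sumr_const -[leLHS]mulr_natl ler_wpM2r ?expR_ge0 //.
by have := dl_sqK dl 1%g; rewrite -(ler_nat R) -mul2n natrM.
Qed.

Hypothesis p12 : p <= 1 / 2.

Lemma expR_le_1B (u : R) : 0 <= u <= 1 / 2 -> expR (- (u + 2 * u ^+ 2)) <= 1 - u.
Proof.
move=> u01; rewrite expRN -[leRHS]invrK.
rewrite lef_pV2 ?posrE ?invr_gt0 ?expR_gt0 //; last by lra.
apply: le_trans (expR_ge1Dx _); rewrite -div1r ler_pdivrMr; nra.
Qed.

(** Requiring [z] to be outside [S] costs a factor [1 - p], absorbed in [2 p]. Rounding half the arc
    count up costs the [+ 1]. *)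
Lemma Pr_nreach2_ge z : z \in Z -> z != 1%g ->
  expR (- (2 * p + (p ^+ 2 + 2 * p ^+ 4) *
    (((arcs (prod_adj z) [set: gT])%:R + 1) / 2))) <=
  Pr p (fun S => ~~ reach2 S z).
Proof.
move=> zZ z1; set a := arcs _ _.
have [p0 p1] := andP p01; have p_le := p12.
have lb : (1 - p) * (1 - p ^+ 2) ^+ uphalf a <= Pr p (fun S => ~~ reach2 S z).
  apply: (@le_trans _ _ (Pr p (fun S => (z \notin S) && indep (prod_adj z) [set: gT] S))).
    rewrite (Pr_cond _ z); apply: ler_wpDr; first by rewrite mulr_ge0 ?Pr_ge0.
    rewrite ler_wpM2l ?subr_ge0 //.
    rewrite (eq_Pr _ (F := indep (prod_adj z) ([set: gT] :\ z))); last first.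
      by move=> S; rewrite setD11 indepD1.
    apply: (Pr_indep_ge p01 (@prod_adj_sym _ z) (@prod_adj_irr _ z)).
    have := arcsD1 (@prod_adj_sym _ z) (@prod_adj_irr _ z) (in_setT z).
    by rewrite -/a; lia.
  by apply: Pr_mono => // S /andP[zS]; apply: (indep_nreach2 dl).
apply: le_trans lb; rewrite opprD expRD; apply: ler_pM; rewrite ?expR_ge0 //.
  have /expR_le_1B : 0 <= p <= 1 / 2 by rewrite p0.
  apply: le_trans; rewrite ler_expR lerN2.
  have : 0 <= p * (1 - 2 * p) by rewrite mulr_ge0 //; lra.
  by rewrite mulrBr mulrCA -expr2; lra.
apply: (@le_trans _ _ (expR (- (p ^+ 2 + 2 * p ^+ 4) * (uphalf a)%:R))).
  rewrite mulNr ler_expR lerN2 ler_wpM2l //; first by nra.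
  have : ((uphalf a).*2 <= a + 1)%N by lia.
  by rewrite -(ler_nat R) natrD -mul2n natrM; lra.
rewrite mulrC expRM_natl; apply: lerXn2r; rewrite ?nnegrE ?expR_ge0 //.
  by nra.
have -> : p ^+ 4 = (p ^+ 2) ^+ 2 by rewrite -exprM.
by apply: expR_le_1B; apply/andP; split; nra.
Qed.

(** The two graphs share no edge, so the exponent for their union agrees to leading order with the
    sum of the two exponents in [Pr_nreach2_ge]. *)
Lemma Pr_nreach2_corr z z' : z \in Z -> z' \in Z -> z != 1%g -> z' != 1%g ->
    z != z' ->
  Pr p (fun S => ~~ reach2 S z && ~~ reach2 S z') <=
  expR (100 * N * p ^+ 3 + 6 * p) *
    (Pr p (fun S => ~~ reach2 S z) * Pr p (fun S => ~~ reach2 S z')).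
Proof.
move=> zZ z'Z z1 z'1 zz'.
have [p0 p1] := andP p01; have p_le := p12.
set P1 := Pr p (fun S => ~~ reach2 S z); set P2 := Pr p (fun S => ~~ reach2 S z').
apply: (@le_trans _ _ (Pr p (indep (adj2 z z') [set: gT]))).
  apply: Pr_mono => // S /andP[/nreach2_indep/indepP i1 /nreach2_indep/indepP i2].
  by apply/indepP => s t sA sS tA tS; rewrite negb_or i1 ?i2.
apply: le_trans (Pr_indep_le (r := p) p01 (@adj2_sym _ z z') (@adj2_irr _ z z') _ _
  (adj2_deg z z')) _; first by rewrite p0 lexx.
apply: le_trans (ler_wpM2l (expR_ge0 _) (ler_pM (expR_ge0 _) (expR_ge0 _)
  (Pr_nreach2_ge zZ z1) (Pr_nreach2_ge z'Z z'1))).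
(* Degree 16 gives the error [64 p^3] per edge, for at most [3 N / 2] edges, so [96 N p^3]; the
   terms in [N p^4] fit in the remaining [4 N p^3]. *)
rewrite (arcs_adj2 dl zZ z'Z zz') natrD -!expRD ler_expR.
have := arcs_central dl zZ; have := arcs_central dl z'Z.
rewrite -!(ler_nat R) natrM natr_card_half.
set a := (arcs _ _)%:R; set a' := (arcs _ _)%:R => a3 a'3.
have [a0 a'0] : 0 <= a /\ 0 <= a' by rewrite !ler0n.
have p3 : 0 <= p ^+ 3 by rewrite exprn_ge0.
have p4 : p ^+ 4 <= p ^+ 3 / 2 by rewrite exprS; nra.
have p40 : 0 <= p ^+ 4 by rewrite exprn_ge0.
have p2 : p ^+ 2 <= p / 2 by nra.
have p3' : p ^+ 3 <= p / 4 by rewrite exprS; nra.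
have le1 := ler_wpM2l p3 (lerD a3 a'3).
have le2 := ler_wpM2l p40 (lerD a3 a'3).
have le3 : N * p ^+ 4 <= N * (p ^+ 3 / 2) by rewrite ler_wpM2l.
have N0 : 0 <= N * p ^+ 3 by rewrite mulr_ge0.
by lra.
Qed.

(** The second moment method over the [L - 1] nontrivial elements of [Z], each with at most
    [3 N / 4] edges in its graph. *)
Lemma Pr_forall_reach2_le : (1 < L)%N ->
  Pr p (fun S => ~~ [exists x, (x != 1%g) && ~~ reach2 S x]) <=
  ((L%:R - 1) * expR (- (3 / 4 * N * p ^+ 2 + N * p ^+ 3 + 4 * p)))^-1 +
  expR (100 * N * p ^+ 3 + 6 * p) - 1.
Proof.
move=> L1; have [p0 p1] := andP p01; have p_le := p12.
pose P z := (z \in Z) && (z != 1%g).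
set M0 := (L%:R - 1) * _.
have M00 : 0 < M0 by rewrite mulr_gt0 ?expR_gt0 // subr_gt0 ltr1n.
set M := \sum_(z | P z) Pr p (fun S => ~~ reach2 S z).
have leM : M0 <= M.
  have cardP : #|[set z | P z]| = L.-1.
    rewrite -(dl_cardZ dl) (cardsD1 1%g Z) (dl_Z1 dl) add1n /=.
    by apply: eq_card => z; rewrite !inE andbC.
  have -> : M0 = \sum_(z | P z) expR (- (3 / 4 * N * p ^+ 2 + N * p ^+ 3 + 4 * p)).
    rewrite (eq_bigl (mem [set z | P z])) => [|z]; last by rewrite !inE.
    by rewrite sumr_const cardP -[RHS]mulr_natl -subn1 natrB // ltnW.
  apply: ler_sum => z /andP[zZ z1]; apply: le_trans (Pr_nreach2_ge zZ z1).
  rewrite ler_expR lerN2.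
  have := arcs_central dl zZ; rewrite -(ler_nat R) natrM natr_card_half.
  set a := (arcs _ _)%:R => a3.
  have p3 : 0 <= p ^+ 3 by rewrite exprn_ge0.
  have p4 : p ^+ 4 <= p ^+ 3 / 2 by rewrite exprS; nra.
  have p40 : 0 <= p ^+ 4 by rewrite exprn_ge0.
  have p2 : p ^+ 2 <= p / 2 by nra.
  have p3' : p ^+ 3 <= p / 4 by rewrite exprS; nra.
  have le1 := ler_wpM2l (sqr_ge0 p) a3.
  have le2 := ler_wpM2l p40 a3.
  have le3 : N * p ^+ 4 <= N * (p ^+ 3 / 2) by rewrite ler_wpM2l.
  have N0 : 0 <= N * p ^+ 3 by rewrite mulr_ge0.
  by lra.
apply: (@le_trans _ _ (M^-1 + expR (100 * N * p ^+ 3 + 6 * p) - 1)); last first.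
  by rewrite lerD2r lerD2r lef_pV2 ?posrE // (lt_le_trans M00).
apply: (@le_trans _ _ (Pr p (fun S => ~~ [exists z, P z && ~~ reach2 S z]))).
  apply: Pr_mono => // S; apply: contra => /existsP[z /andP[/andP[_ z1] nz]].
  by apply/existsP; exists z; rewrite z1.
apply: (Pr_second_moment p01 (P := P) (E := fun z S => ~~ reach2 S z)) => //.
  by move=> z z' /andP[zZ z1] /andP[z'Z z'1]; apply: Pr_nreach2_corr.
exact: lt_le_trans leM.
Qed.

End DihedralLikeProbability.

(** * The groups [C_2^n x D_2m] are dihedral-like *)

Section DihedralGroups.
Import mathcomp.boot.fintype mathcomp.boot.finset.
Local Open Scope group_scope.

(** Squares in the product have the form [(1, t^2)]: square roots are counted in [C] alone, and
    [V x 1] contains no square but 1. *)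
Lemma dihedral_like_prod (V D : finGroupType) (C : {group D}) :
    (forall v : V, v * v = 1) ->
    #|~: C| = #|C| -> (forall t, t \notin C -> t * t = 1) ->
    (forall y, (#|[set t in C | (t * t == y)%g]| <= 2)%N) ->
  dihedral_like (setX_group [set: V]%G C) (setX [set: V] 1) #|V|.
Proof.
move=> vv cardC invC sqC.
have mulE (a b : V * D) : a * b = (a.1 * b.1, a.2 * b.2) by [].
have vC (v w : V) : v * w = w * v.
  have inv (u : V) : u^-1 = u by apply/eqP; rewrite eq_invg_mul vv.
  by rewrite -[LHS]inv invMg !inv.
split => /=.
- have := cardsC (setX [set: V] C); have := cardsC C.
  by rewrite cardC cardsX cardsT card_prod => <-; rewrite mulnDr => /addnI.
- by move=> [v t]; rewrite !inE /= => /invC tt; rewrite ?mulE /= vv tt.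
- move=> [y1 y2]; rewrite -muln2 -cardsT.
  apply: leq_trans (leq_mul (leqnn _) (sqC y2)); rewrite -cardsX.
  apply/subset_leq_card/subsetP => [[v t]]; rewrite !inE /= => /andP[-> /=].
  by rewrite mulE /= => /eqP[_ ->].
- by rewrite cardsX cards1 muln1 cardsT.
- by rewrite !inE /= eqxx.
- by move=> [z z2] [v t]; rewrite !inE /= => /eqP ->; rewrite ?mulE /= vC mulg1 mul1g.
- by move=> [z z2] [v t]; rewrite !inE /= => /eqP -> /eqP ->; rewrite ?mulE /= mulg1.
- by move=> [z z2]; rewrite !inE /= => /eqP ->; rewrite ?mulE /= mulg1 vv.
- by move=> [v t]; rewrite !inE mulE /= vv => /eqP ->.
Qed.

Lemma card_C2_pow n : #|C2_pow n| = (2 ^ n)%N.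
Proof.
rewrite /C2_pow card_dep_ffun card_ord.
by rewrite foldrE big_map big_enum /= prod_nat_const card_ord.
Qed.

Lemma C2_pow_mul n (v : C2_pow n) : v * v = 1.
Proof.
apply/ffunP => i; rewrite mulg_ffun [RHS]ffunE.
by apply/val_inj; case: (v i) => [[|[|]]].
Qed.

(** Two square roots of [y] differ by a square root of 1, and a cyclic group has at most one
    involution. *)
Lemma cyclic_card_sqrt (gT : finGroupType) (C : {group gT}) (y : gT) :
  cyclic C -> (#|[set t in C | (t * t == y)%g]| <= 2)%N.
Proof.
move=> cycC.
have ord2 u : u \in C -> u * u = 1 -> u != 1 -> #[u] = 2.
  by move=> uC uu u1; apply: nt_prime_order; rewrite // expgS expg1.
have [->|[t0]] := set_0Vmem [set t in C | t * t == y]; first by rewrite cards0.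
rewrite inE => /andP[t0C /eqP t0y].
have cC := cyclic_abelian cycC.
rewrite -(card_imset _ (mulIg t0^-1)).
suff sub1 : forall u w, u \in C -> w \in C -> u * u = 1 -> w * w = 1 ->
    u != 1 -> w != 1 -> u = w.
  set A := imset _ _; have A1 u : u \in A -> u \in C /\ u * u = 1.
    case/imsetP => t; rewrite inE => /andP[tC /eqP ty] ->.
    split; first by rewrite groupM ?groupV.
    have comm : commute t t0^-1 by apply: (centsP cC); rewrite ?groupV.
    by rewrite mulgA -(mulgA t) -comm mulgA ty -t0y mulgK mulgV.
  have [sA|] := boolP (A \subset [set 1]).
    by apply: leq_trans (subset_leq_card sA) _; rewrite cards1.
  case/subsetPn => u uA; rewrite inE => u1; have [uC uu] := A1 u uA.
  apply: (@leq_trans #|[set 1; u]|); last by rewrite cards2; case: (_ != _).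
  apply/subset_leq_card/subsetP => w wA; have [wC ww] := A1 w wA.
  rewrite !inE; have [//|w1] := eqVneq w 1 => /=.
  by rewrite (sub1 w u).
move=> u w uC wC uu ww u1 w1; have ou := ord2 u uC uu u1; have ow := ord2 w wC ww w1.
(* Subgroups of equal order in a cyclic group coincide. *)
have : <[u]> == <[w]>.
  by rewrite (eq_subG_cyclic cycC) ?cycle_subG // -!orderE ou ow.
rewrite (cycle2g ou) (cycle2g ow) => /eqP/setP/(_ u).
by rewrite !inE eqxx orbT (negbTE u1) => /esym/eqP.
Qed.

(** From the presentation, [x] has order at most [m] and [y] at most 2, while their cyclic groups
    generate a group of order [2 m]; hence [x] has order exactly [m]. A reflection [x^k y] squares
    to 1 because [y] inverts [x]. *)
Lemma dihedral_rotations m : (1 < m)%N -> exists C : {group dihedral m},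
  [/\ #|C| = m, #|~: C| = m, forall t, t \notin C -> t * t = 1
    & forall y, (#|[set t in C | (t * t == y)%g]| <= 2)%N].
Proof.
move=> m1; rewrite /dihedral gtn_eqF // mul2n.
have := isog_refl [set: dihedral_gtype m.*2]%G.
case/(isoGrpP _ (Grp_dihedral m1)) => _.
have oG := card_dihedral m1.
case/existsP => -[x y] /= /eqP[defG xm y2 xy].
have nyx : <[y]> \subset 'N(<[x]>).
  by rewrite cycle_subG; apply/normP; rewrite -cycleJ xy cycleV.
have prodG : <[x]> * <[y]> = [set: dihedral_gtype m.*2] by rewrite -norm_joinEr.
have ox : (#[x] <= m)%N by rewrite dvdn_leq ?(ltnW m1) // order_dvdn xm.
have oy : (#[y] <= 2)%N by rewrite dvdn_leq // order_dvdn y2.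
have := mul_cardG <[x]> <[y]>; rewrite prodG oG -!orderE => cardM.
have cap1 : (0 < #|<[x]> :&: <[y]>|)%N by rewrite cardG_gt0.
have oxm : #[x] = m.
  apply/eqP; rewrite eqn_leq ox -leq_double -[#[x].*2]muln2 /=.
  by apply: leq_trans (leq_mul (leqnn _) oy); rewrite cardM leq_pmulr.
exists <[x]>%G; split => //=.
- apply: (@addnI m); rewrite -{1}oxm orderE cardsC -cardsT oG.
  by rewrite -[LHS]addnn.
- move=> t tx; have : t \in <[x]> * <[y]> by rewrite prodG inE.
  case/mulsgP => c d cx dy tcd; move: tx; rewrite tcd.
  case/cycleP: dy => i ->; rewrite -(odd_double_half i) expgD -(mul2n i./2) expgM y2.
  rewrite expg1n mulg1; case: (odd i); last by rewrite expg0 mulg1 cx.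
  rewrite expg1 => _; case/cycleP: cx => k ->.
  have yk : x ^+ k * y = y * x ^- k.
    by rewrite -expVgn -xy -conjXg conjgE !mulgA mulgV mul1g.
  have yy : y * y = 1 by rewrite -y2 expgS expg1.
  by rewrite {2}yk -!mulgA (mulgA y) yy mul1g mulgV.
by move=> z; apply: cyclic_card_sqrt; apply: cycle_cyclic.
Qed.

Lemma C2_pow_dihedral_like n m : (1 < m)%N ->
  exists (K : {group (C2_pow n * dihedral m)%type})
    (Z : {set (C2_pow n * dihedral m)%type}),
    dihedral_like K Z (2 ^ n)%N.
Proof.
move=> /dihedral_rotations[C [cC cC' invC sqC]]; rewrite -card_C2_pow.
exists (setX_group [set: C2_pow n]%G C), (setX [set: C2_pow n] 1).
by apply: dihedral_like_prod => //; [exact: C2_pow_mul|rewrite cC].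
Qed.

Lemma card_C2_pow_dihedral n m : (1 < m)%N ->
  #|{: C2_pow n * dihedral m}| = (2 ^ n * m.*2)%N.
Proof.
move=> /dihedral_rotations[C [cC cC' _ _]].
by rewrite card_prod card_C2_pow -(cardsC C) cC cC' addnn.
Qed.

End DihedralGroups.

(** * Explicit estimates for one group, under inequalities that hold for large [n] *)

Section FiniteEstimates.
Variables (R : realType) (gT : finGroupType) (K : {group gT}) (Z : {set gT}).
Variables (L : nat) (c : R).
Hypotheses (dl : dihedral_like K Z L) (hc : 1 <= c < 4 / 3).
Local Notation N := (#|gT|%:R : R).
Local Notation l := (ln N).

Lemma Pr_diam_le2_ge (eps eta p : R) : 0 < eps -> 0 < eta -> 0 <= p <= 1 ->
    let r := Num.sqrt ((c + eps) * (l / N)) in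
    r <= p -> 0 <= l -> 128 * (c + eps) * r <= eps ->
    11 * (c + eps) * L%:R <= eps * N ->
    ln L%:R <= 3 * c / 4 * l -> - (3 / 8 * eps * l) <= ln (eta / 3) ->
  1 - eta <= Pr_cayley p (fun e : rel gT => (diameter R e <= 2%:E)%E).
Proof.
move=> eps0 eta0 p01 r rp l0 r_le L_le lnL l_ge.
have [c1 c43] := andP hc.
have N0 : 0 < N by rewrite ltr0n; apply/card_gt0P; exists 1%g.
have r0 : 0 <= r by exact: sqrtr_ge0.
have r2 : r ^+ 2 = (c + eps) * (l / N).
  by rewrite sqr_sqrtr // mulr_ge0 ?divr_ge0 ?(ltW N0) //; lra.
have r2N : r ^+ 2 * N = (c + eps) * l by rewrite r2 -mulrA mulfVK ?gt_eqF.
have C0 : 0 < c + eps by lra.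
have r32 : 32 * r <= 1 / 4.
  have : r <= eps / (128 * (c + eps)) by rewrite ler_pdivlMr; lra.
  move/le_trans; move=> H; have : r <= 1 / 128.
    apply: H; rewrite ler_pdivrMr; lra.
  by lra.
rewrite Pr_cayley_diam_le2 Pr_negb lerD2l lerN2.
apply: le_trans (Pr_exists_nreach2_le dl p01 (r := r) _ _) _; first by rewrite r0.
  by lra.
set q := 1 - 32 * r.
(* The loss in q and in L / N consumes at most half of eps. *)
have main t : 0 <= t -> 8 * t <= 22 * L%:R -> (c + eps / 2) * l <= r ^+ 2 * q * (N - t).
  move=> t0 tL.
  have -> : r ^+ 2 * q * (N - t) = q * (r ^+ 2 * N * (1 - t / N)).
    by field; rewrite gt_eqF.
  rewrite r2N.
  (* From [8 t <= 22 L], [(c + eps) t <= 11 (c + eps) L / 4 <= eps N / 4]. The 22 covers both uses,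
     [t = 2 L] and [t = 8 L / 3]. *)
  have tN : (c + eps) * (t / N) <= eps / 4.
    by rewrite mulrA ler_pdivrMr // ; nra.
  have tN0 : 0 <= t / N by rewrite divr_ge0 // ltW.
  have qq : (c + eps) - eps / 2 <= q * ((c + eps) * (1 - t / N)).
    by rewrite /q; move: (t / N) tN tN0 => u *; nra.
  by have := ler_wpM2r l0 qq; lra.
have LN : L%:R <= expR (3 * c / 4 * l).
  have [->|L0] := posnP L; first by rewrite expR_ge0.
  by rewrite -ler_ln ?posrE ?expR_gt0 ?ltr0n // expRK.
have eN : N = expR l by rewrite lnK ?posrE.
have L0 : 0 <= L%:R :> R by [].
have t1 : N * expR (- (r ^+ 2 * q) * (N - 2 * L%:R)) <= expR (- (3 / 8 * eps * l)).
  rewrite {1}eN -expRD ler_expR mulNr.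
  by have := main (2 * L%:R) ltac:(lra) ltac:(lra); nra.
(* Here [3 N / 4 - 2 L] is [3 / 4] of [N - 8 L / 3], and the exponent
   [3 c l / 4 - 3 (c + eps / 2) l / 4] is exactly [- 3 eps l / 8]. *)
have t2 : 2 * L%:R * expR (- (r ^+ 2 * q) * (3 / 4 * N - 2 * L%:R)) <=
    2 * expR (- (3 / 8 * eps * l)).
  rewrite -mulrA ler_wpM2l //.
  apply: le_trans (ler_wpM2r (expR_ge0 _) LN) _; rewrite -expRD ler_expR mulNr.
  by have := main (8 / 3 * L%:R) ltac:(lra) ltac:(lra); nra.
have : expR (- (3 / 8 * eps * l)) <= eta / 3.
  by rewrite -[leRHS]lnK ?posrE ?divr_gt0 // ler_expR.
by lra.
Qed.

Lemma Pr_diam_gt2_ge (eps eta tau p : R) : 0 < eps -> eps < c -> 0 < eta ->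
    0 <= p <= 1 ->
    let r := Num.sqrt ((c - eps) * (l / N)) in
    p <= r -> 0 <= l -> tau <= 1 / 2 -> r <= tau -> N * r ^+ 3 <= tau ->
    106 * tau <= ln (1 + eta / 2) -> (1 < L)%N ->
    3 * c / 4 * (l - ln 2) <= ln L%:R ->
    6 - 3 / 4 * eps * l <= ln (eta / 4) ->
  1 - eta <= Pr_cayley p (fun e : rel gT => (2%:E < diameter R e)%E).
Proof.
move=> eps0 epsc eta0 p01 r pr l0 tau1 r_tau Nr3 tau_le L1 lnL l_ge.
have [c1 c43] := andP hc; have [p0 p1] := andP p01.
have N0 : 0 < N by rewrite ltr0n; apply/card_gt0P; exists 1%g.
have r0 : 0 <= r by exact: sqrtr_ge0.
have r2 : r ^+ 2 = (c - eps) * (l / N).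
  by rewrite sqr_sqrtr // mulr_ge0 ?divr_ge0 ?(ltW N0) //; lra.
have r2N : N * r ^+ 2 = (c - eps) * l by rewrite mulrC r2 -mulrA mulfVK ?gt_eqF.
have Np2 : N * p ^+ 2 <= (c - eps) * l.
  by rewrite -r2N ler_wpM2l ?(ltW N0) // lerXn2r.
have Np3 : N * p ^+ 3 <= tau.
  by apply: le_trans Nr3; rewrite ler_wpM2l ?(ltW N0) // lerXn2r.
rewrite Pr_cayley_diam_gt2.
have := Pr_forall_reach2_le dl p01 ltac:(lra) L1.
rewrite Pr_negb; set P := Pr _ _ => leP.
have e1 : expR (100 * N * p ^+ 3 + 6 * p) <= 1 + eta / 2.
  by rewrite -[leRHS]lnK ?posrE ?addr_gt0 ?divr_gt0 // ler_expR; lra.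
have ln2 : ln 2 <= 1 :> R.
  by have := @le_ln1Dx R 1 ltac:(lra); rewrite -[1 + 1]/(2%:R); lra.
have L0 : 0 < L%:R :> R by rewrite ltr0n ltnW.
have L12 : L%:R / 2 <= L%:R - 1 :> R.
  by have : 2%:R <= L%:R :> R; [rewrite ler_nat | lra].
have eL : L%:R = expR (ln L%:R) :> R by rewrite lnK ?posrE.
(* Since [ln L] is at least [3 c (l - ln 2) / 4], the expected count grows like
   [expR (3 / 4 * eps * l)]; the 6 in the hypothesis covers [3 c ln 2 / 4], [N p^3] and [4 p]. *)
have e2 : ((L%:R - 1) * expR (- (3 / 4 * N * p ^+ 2 + N * p ^+ 3 + 4 * p)))^-1 <= eta / 2.
  rewrite -[leRHS]invrK lef_pV2 ?posrE ?invr_gt0 ?divr_gt0 //; last first.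
    by rewrite mulr_gt0 ?expR_gt0 //; lra.
  apply: (@le_trans _ _ (L%:R / 2 *
      expR (- (3 / 4 * N * p ^+ 2 + N * p ^+ 3 + 4 * p)))); last first.
    by rewrite ler_wpM2r ?expR_ge0.
  rewrite eL mulrAC -expRD ler_pdivlMr // invf_div.
  have -> : 2 / eta * 2 = (eta / 4)^-1 by field; rewrite gt_eqF.
  rewrite -[in leLHS](lnK (_ : eta / 4 \is Num.pos)) ?posrE ?divr_gt0 //.
  rewrite -expRN ler_expR.
  have : 3 * c / 4 * ln 2 <= 1 by nra.
  by nra.
by lra.
Qed.

End FiniteEstimates.


(** * Growth of the orders and passage to the limit *)

Section Asymptotics.
Local Open Scope classical_set_scope.
Variables (R : realType) (c : R).
Hypothesis hc : 1 <= c < 4 / 3.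
Local Notation G n := (C2_pow n * dihedral (dihedral_param c n))%type.
Local Notation N n := (#|{: G n}|%:R : R).
Local Notation a := ((4 - 3 * c) / (3 * c)).

Let c1 : 1 <= c. Proof. by case/andP: hc. Qed.
Let c43 : c < 4 / 3. Proof. by case/andP: hc. Qed.

Let a0 : 0 < a.
Proof. by have := c1; have := c43 => ? ?; rewrite divr_gt0; lra. Qed.

Let ln2_gt0 : 0 < ln 2 :> R. Proof. by rewrite ln_gt0 // ltr1n. Qed.

Lemma near_mul_natr (A b : R) : 0 < b -> \forall n \near \oo, A <= b * n%:R.
Proof.
move=> b0; near=> n; rewrite mulrC -ler_pdivrMr //.
by near: n; apply: nbhs_infty_ger.
Unshelve. all: by end_near. Qed.

Lemma dihedral_param_itv n :
  (dihedral_param c n)%:R <= expR (a * ln 2 * n%:R) < (dihedral_param c n).+1%:R.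
Proof.
have -> : expR (a * ln 2 * n%:R) = 2 `^ ((4 - 3 * c) * n%:R / (3 * c)).
  by rewrite /powR pnatr_eq0 /=; congr expR; ring.
by apply: Num.Theory.truncn_itv; rewrite powR_ge0.
Qed.

(** This is where [c < 4 / 3] enters: it makes the exponent [a] positive. *)
Lemma near_dihedral_param_ge (A : R) :
  \forall n \near \oo, A <= (dihedral_param c n)%:R.
Proof.
near=> n; have /andP[_] := dihedral_param_itv n.
have : A <= a * ln 2 * n%:R by near: n; apply: near_mul_natr; rewrite mulr_gt0.
by have := expR_ge1Dx (a * ln 2 * n%:R); rewrite -natr1 => ? ? ?; lra.
Unshelve. all: by end_near. Qed.

Lemma near_dihedral_param_gt M : \forall n \near \oo, (M < dihedral_param c n)%N.
Proof.
near=> n; rewrite -(ler_nat R).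
by near: n; apply: near_dihedral_param_ge.
Unshelve. all: by end_near. Qed.

Lemma near_card : \forall n \near \oo,
  N n = 2 ^+ n * (2 * (dihedral_param c n)%:R).
Proof.
near=> n; rewrite card_C2_pow_dihedral; last by near: n; apply: near_dihedral_param_gt.
by rewrite -mul2n !natrM natrX.
Unshelve. all: by end_near. Qed.

(** As [m] is the floor of [2^(a n)], [2 m] lies between [2^(a n)] and twice it, so [ln N] is
    [(1 + a) n ln 2] up to an error in [[0, ln 2]]; and [1 + a = 4 / (3 c)]. *)
Lemma near_ln_card : \forall n \near \oo,
  ln 2 * n%:R <= 3 * c / 4 * ln (N n) /\
  3 * c / 4 * (ln (N n) - ln 2) <= ln 2 * n%:R.
Proof.
near=> n; have -> : N n = 2 ^+ n * (2 * (dihedral_param c n)%:R).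
  by near: n; apply: near_card.
have m1 : (1 < dihedral_param c n)%N by near: n; apply: near_dihedral_param_gt.
have /andP[] := dihedral_param_itv n; move: m1.
move: (dihedral_param c n) => m m1 mx xm.
have m2 : 2 <= m%:R :> R by rewrite ler_nat.
have m0 : 0 < m%:R :> R by lra.
have x_le : expR (a * ln 2 * n%:R) <= 2 * m%:R by move: xm; rewrite -natr1; lra.
rewrite !lnM ?posrE ?exprn_gt0 ?mulr_gt0 // lnXn // -(mulr_natr (ln 2) n).
have ln_le : ln m%:R <= a * ln 2 * n%:R.
  by rewrite -[leRHS]expRK ler_ln ?posrE ?expR_gt0.
have ln_ge : a * ln 2 * n%:R <= ln 2 + ln m%:R.
  by rewrite -[leLHS]expRK -lnM ?posrE // ler_ln ?posrE ?expR_gt0 ?mulr_gt0.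
have c_gt0 : 0 < c by have := c1; lra.
have aE : 3 * c / 4 * a = 1 - 3 * c / 4 by field; rewrite gt_eqF.
have c0 : 0 <= 3 * c / 4 by lra.
have := ler_wpM2l c0 ln_le; have := ler_wpM2l c0 ln_ge.
have -> : 3 * c / 4 * (a * ln 2 * n%:R) = (1 - 3 * c / 4) * (ln 2 * n%:R).
  by rewrite -aE; ring.
by move: (ln m%:R) (ln 2) => y u; split; lra.
Unshelve. all: by end_near. Qed.

Lemma ln_card_ge0 n : 0 <= ln (N n).
Proof. by rewrite ln_ge0 // ler1n; apply/card_gt0P; exists 1%g. Qed.

Lemma near_ln_card_ge (A b : R) : 0 < b -> \forall n \near \oo, A <= b * ln (N n).
Proof.
move=> b0; near=> n; have [le_l _] : ln 2 * n%:R <= 3 * c / 4 * ln (N n) /\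
    3 * c / 4 * (ln (N n) - ln 2) <= ln 2 * n%:R.
  by near: n; apply: near_ln_card.
have : A <= b * ln 2 * n%:R.
  by near: n; apply: near_mul_natr; rewrite mulr_gt0.
move/le_trans; apply; rewrite -mulrA ler_wpM2l ?(ltW b0) //.
apply: le_trans le_l _; have := ln_card_ge0 n.
by have := c43; nra.
Unshelve. all: by end_near. Qed.

(** With [l = ln N], the exponential series gives [N >= l^4 / 24]. *)
Lemma near_cube_ln_card (b : R) : 0 < b ->
  \forall n \near \oo, (ln (N n)) ^+ 3 <= b * N n.
Proof.
move=> b0; near=> n.
have : 24 <= b * ln (N n) by near: n; apply: near_ln_card_ge.
set l := ln _ => bl.
have l0 : 0 <= l by exact: ln_card_ge0.
have N0 : 0 < N n by rewrite ltr0n; apply/card_gt0P; exists 1%g.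
have := expR_ge1Dxn 3 l0; rewrite /l lnK ?posrE // -/l -[4`!]/24%N => le_N.
have : l ^+ 4 / 24 <= N n by lra.
move/(ler_wpM2l (ltW b0)); apply: le_trans.
rewrite exprS; have := ler_wpM2r (exprn_ge0 3 l0) bl; lra.
Unshelve. all: by end_near. Qed.

(** With [r] the square root, [r^2 = C l / N] and [(N r^3)^2 = C^3 l^3 / N]; both are small by the
    cubic bound, as [l <= l^3]. *)
Lemma near_sqrt_small (C tau : R) : 0 < C -> 0 < tau -> \forall n \near \oo,
  Num.sqrt (C * (ln (N n) / N n)) <= tau /\
  N n * Num.sqrt (C * (ln (N n) / N n)) ^+ 3 <= tau.
Proof.
move=> C0 tau0; near=> n.
have : 1 <= 1 * ln (N n) by near: n; apply: near_ln_card_ge.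
have : ln (N n) ^+ 3 <= tau ^+ 2 / C * N n.
  by near: n; apply: near_cube_ln_card; rewrite divr_gt0 ?exprn_gt0.
have : ln (N n) ^+ 3 <= tau ^+ 2 / C ^+ 3 * N n.
  by near: n; apply: near_cube_ln_card; rewrite divr_gt0 ?exprn_gt0.
set l := ln _; set r := Num.sqrt _; rewrite mul1r => l3' l3 l1.
have N0 : 0 < N n by rewrite ltr0n; apply/card_gt0P; exists 1%g.
have r2 : r ^+ 2 = C * (l / N n).
  by rewrite sqr_sqrtr // mulr_ge0 ?divr_ge0 ?(ltW N0) //; lra.
split.
  rewrite -(@ler_pXn2r _ 2) ?nnegrE ?sqrtr_ge0 ?(ltW tau0) // r2.
  rewrite mulrA ler_pdivrMr // -ler_pdivlMl // mulrA [C^-1 * _]mulrC.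
  by apply: le_trans l3; rewrite -[leLHS]expr1; apply: ler_weXn2l.
rewrite -(@ler_pXn2r _ 2) ?nnegrE ?mulr_ge0 ?exprn_ge0 ?sqrtr_ge0 ?(ltW N0)
  ?(ltW tau0) //.
have -> : (N n * r ^+ 3) ^+ 2 = N n ^+ 2 * (r ^+ 2) ^+ 3 by ring.
rewrite r2; have -> : N n ^+ 2 * (C * (l / N n)) ^+ 3 = C ^+ 3 * l ^+ 3 / N n.
  by field; rewrite gt_eqF.
by rewrite ler_pdivrMr // -ler_pdivlMl ?exprn_gt0 // mulrA [(C ^+ 3)^-1 * _]mulrC.
Unshelve. all: by end_near. Qed.

Lemma near_dihedral_like : \forall n \near \oo, exists K Z,
  @dihedral_like (G n) K Z (2 ^ n)%N.
Proof.
near=> n; apply: C2_pow_dihedral_like.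
by near: n; apply: near_dihedral_param_gt.
Unshelve. all: by end_near. Qed.

Lemma cvg_card : #|{: G n}| @[n --> \oo] --> \oo.
Proof.
apply/cvgnyPge => A; near=> n.
rewrite card_C2_pow_dihedral; last by near: n; apply: near_dihedral_param_gt.
have m1 : (1 < dihedral_param c n)%N by near: n; apply: near_dihedral_param_gt.
have An : (A <= n)%N by near: n; apply: nbhs_infty_ge.
apply: leq_trans An _; apply: leq_trans (ltnW (ltn_expl n (ltnSn 1))) _.
by rewrite leq_pmulr // double_gt0 ltnW.
Unshelve. all: by end_near. Qed.

Lemma cvg_diam_gt2 (eps : R) (p : nat -> R) : 0 < eps ->
    (forall k, 0 <= p k <= 1) ->
    (\forall k \near \oo, p k <= Num.sqrt ((c - eps) * (ln (N k) / N k))) ->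
  Pr_cayley (p k) (fun e : rel (G k) => (2%:E < diameter R e)%E)
    @[k --> \oo] --> (1 : R).
Proof.
move=> eps0 p01 bnd; apply/cvgrPdist_le => eta eta0.
have c0 : 0 < c by have := c1; lra.
(* For [eps >= c] the radicand is not positive and the root defaults to 0. A smaller [eps'] weakens
   the bound on [p] and keeps [c - eps'] positive. *)
pose eps' := Num.min eps (c / 2).
have eps'0 : 0 < eps' by rewrite lt_min eps0 divr_gt0.
have eps'e : eps' <= eps by rewrite ge_min lexx.
have eps'c : eps' < c.
  by apply: le_lt_trans (_ : c / 2 < c); [rewrite ge_min lexx orbT|lra].
pose tau := Num.min (1 / 2) (ln (1 + eta / 2) / 106).
have ln0 : 0 < ln (1 + eta / 2) by rewrite ln_gt0 // ltrDl divr_gt0.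
have tau0 : 0 < tau by rewrite lt_min !divr_gt0.
have tau12 : tau <= 1 / 2 by rewrite ge_min lexx.
have tau106 : 106 * tau <= ln (1 + eta / 2).
  by rewrite mulrC -ler_pdivlMr // ge_min lexx orbT.
near=> n.
have [K [Z dl]] : exists K Z, @dihedral_like (G n) K Z (2 ^ n)%N.
  by near: n; apply: near_dihedral_like.
have [r_tau Nr3] : Num.sqrt ((c - eps') * (ln (N n) / N n)) <= tau /\
    N n * Num.sqrt ((c - eps') * (ln (N n) / N n)) ^+ 3 <= tau.
  by near: n; apply: near_sqrt_small => //; rewrite subr_gt0.
have [_ lnL] : ln 2 * n%:R <= 3 * c / 4 * ln (N n) /\
    3 * c / 4 * (ln (N n) - ln 2) <= ln 2 * n%:R.
  by near: n; apply: near_ln_card.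
have pn : p n <= Num.sqrt ((c - eps) * (ln (N n) / N n)) by near: n.
have ln_eta : 6 - ln (eta / 4) <= 3 / 4 * eps' * ln (N n).
  by near: n; apply: near_ln_card_ge => //; rewrite mulr_gt0.
have n0 : (0 < n)%N by near: n; apply: nbhs_infty_gt.
rewrite ger0_norm ?subr_ge0; last by apply: Pr_le1.
rewrite lerBlDr -lerBlDl.
apply: (Pr_diam_gt2_ge dl hc (eps := eps') (tau := tau)) => //.
- apply: le_trans pn _.
  by rewrite ler_wsqrtr // ler_wpM2r ?divr_ge0 ?ln_card_ge0 // lerD2l lerN2.
- exact: ln_card_ge0.
- by rewrite -{1}(expn0 2) ltn_exp2l.
- by rewrite natrX lnXn // -(mulr_natr (ln 2) n).
- by lra.
Unshelve. all: by end_near. Qed.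

Lemma cvg_diam_le2 (eps : R) (p : nat -> R) : 0 < eps ->
    (forall k, 0 <= p k <= 1) ->
    (\forall k \near \oo, Num.sqrt ((c + eps) * (ln (N k) / N k)) <= p k) ->
  Pr_cayley (p k) (fun e : rel (G k) => (diameter R e <= 2%:E)%E)
    @[k --> \oo] --> (1 : R).
Proof.
move=> eps0 p01 bnd; apply/cvgrPdist_le => eta eta0.
have C0 : 0 < c + eps by have := c1; lra.
near=> n.
have [K [Z dl]] : exists K Z, @dihedral_like (G n) K Z (2 ^ n)%N.
  by near: n; apply: near_dihedral_like.
have [r_le _] : Num.sqrt ((c + eps) * (ln (N n) / N n)) <= eps / (128 * (c + eps)) /\
    N n * Num.sqrt ((c + eps) * (ln (N n) / N n)) ^+ 3 <= eps / (128 * (c + eps)).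
  by near: n; apply: near_sqrt_small => //; rewrite divr_gt0 ?mulr_gt0.
have [lnL _] : ln 2 * n%:R <= 3 * c / 4 * ln (N n) /\
    3 * c / 4 * (ln (N n) - ln 2) <= ln 2 * n%:R.
  by near: n; apply: near_ln_card.
have pn : Num.sqrt ((c + eps) * (ln (N n) / N n)) <= p n by near: n.
have ln_eta : - ln (eta / 3) <= 3 / 8 * eps * ln (N n).
  by near: n; apply: near_ln_card_ge => //; rewrite mulr_gt0.
have cardE : N n = 2 ^+ n * (2 * (dihedral_param c n)%:R).
  by near: n; apply: near_card.
(* Since [N = 2 m L], the condition that [L / N] be small is a lower bound on [m]. *)
have m_ge : 11 * (c + eps) / eps <= (dihedral_param c n)%:R.
  by near: n; apply: near_dihedral_param_ge.
rewrite ger0_norm ?subr_ge0; last by apply: Pr_le1.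
rewrite lerBlDr -lerBlDl.
apply: (Pr_diam_le2_ge dl hc (eps := eps)) => //.
- exact: ln_card_ge0.
- by rewrite mulrC -ler_pdivlMr ?mulr_gt0.
- rewrite cardE natrX [leRHS]mulrCA [leLHS]mulrC ler_wpM2l ?exprn_ge0 //.
  by move: m_ge; rewrite ler_pdivrMr //; nra.
- by rewrite natrX lnXn // -(mulr_natr (ln 2) n).
- by rewrite lerNl.
Unshelve. all: by end_near. Qed.

End Asymptotics.

Theorem theorem1p4 (R : realType) (c : R) (hc : 1 <= c < 4 / 3) :
  threshold_diam2
    (fun n => (C2_pow n * dihedral (dihedral_param c n))%type : finGroupType) c.
Proof.
split; first by case/andP: hc => ? _; lra.
  exact: cvg_card.
by move=> eps eps0 p p01; split; [exact: cvg_diam_gt2|exact: cvg_diam_le2].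
Qed.
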